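(* Let $\phi\in\Gamma_0(\mathbb{R}^m)$ be Legendre and super-coercive and let $f:\mathbb{R}^m\to\overline{\mathbb{R}}$ be proper, lsc and prox-bounded relative to $\phi$ with threshold $\lambda_f$. Let $f$ be relatively prox-regular (relative to $\phi$) at $\bar x\in\operatorname{int}(\operatorname{dom}\phi)\cap\operatorname{dom}f$ for $\bar v\in\partial f(\bar x)$. If $\lambda\in\,]0,\lambda_f[$ is sufficiently small, then $\overleftarrow{\operatorname{env}}^{\phi}_{\lambda}f\circ\nabla\phi^*$ is $\mathcal{C}^1$ around $\bar y:=\nabla\phi(\bar x)+\lambda\bar v$ with $$\nabla\big(\overleftarrow{\operatorname{env}}^{\phi}_{\lambda}f\circ\nabla\phi^*\big)(y)=\frac1\lambda\big(\nabla\phi^*(y)-\overleftarrow{\operatorname{prox}}^{\phi}_{\lambda}f(\nabla\phi^*(y))\big)$$ for $y$ sufficiently close to $\bar y$. If, furthermore, $\phi$ is very strictly convex, then $\nabla(\overleftarrow{\operatorname{env}}^{\phi}_{\lambda}f\circ\nabla\phi^* )$ is Lipschitz continuous on a neighborhood of $\bar y$.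
   Context: $\overline{\mathbb{R}}=\mathbb{R}\cup\{-\infty,\infty\}$; $\Gamma_0(\mathbb{R}^m)$ is the set of proper lsc convex functions $\mathbb{R}^m\to\overline{\mathbb{R}}$. $\phi\in\Gamma_0(\mathbb{R}^m)$ is Legendre if it is essentially smooth ($\operatorname{int}(\operatorname{dom}\phi)\neq\emptyset$, $\phi$ is differentiable on $\operatorname{int}(\operatorname{dom}\phi)$, and $\|\nabla\phi(x^\nu)\|\to\infty$ whenever $x^\nu\to x\in\operatorname{bdry}\operatorname{dom}\phi$) and essentially strictly convex (strictly convex on every convex subset of $\operatorname{dom}\partial\phi$). Then $\nabla\phi:\operatorname{int}(\operatorname{dom}\phi)\to\operatorname{int}(\operatorname{dom}\phi^* )$ is a bijection with inverse $\nabla\phi^*$ ($\phi^*$ the convex conjugate). Super-coercive: $\phi(x)/\|x\|\to\infty$ as $\|x\|\to\infty$ (equivalently $\operatorname{dom}\phi^*=\mathbb{R}^m$). Very strictly convex: $\phi$ is $\mathcal{C}^2$ on $\operatorname{int}(\operatorname{dom}\phi)\ne\emptyset$ with $\nabla^2\phi(x)$ positive definite for all $x\in\operatorname{int}(\operatorname{dom}\phi)$. $D_\phi(x,y)=\phi(x)-\phi(y)-\langle\nabla\phi(y),x-y\rangle$ if $y\in\operatorname{int}(\operatorname{dom}\phi)$, $+\infty$ otherwise. For $\lambda>0$: $\overleftarrow{\operatorname{env}}^{\phi}_{\lambda}f(y)=\inf_{x} f(x)+\frac1\lambda D_\phi(x,y)$ and $\overleftarrow{\operatorname{prox}}^{\phi}_{\lambda}f(y)=\operatorname{argmin}_{x}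 f(x)+\frac1\lambda D_\phi(x,y)$ over $x\in\mathbb{R}^m$. The gradient formula includes the assertion that the prox is single-valued at the points concerned (and is identified with its single element). $f$ is prox-bounded relative to $\phi$ if there is $\lambda>0$ with $\overleftarrow{\operatorname{env}}^{\phi}_{\lambda}f(y)>-\infty$ for some $y\in\operatorname{int}(\operatorname{dom}\phi)$; the threshold $\lambda_f$ is the supremum of all such $\lambda$. $\partial f$ is the limiting (Mordukhovich) subdifferential. $f$ is locally lsc at $\bar x$ (where $f$ is finite) if there is $\epsilon>0$ such that all sets $\{x:\|x-\bar x\|\le\epsilon,\ f(x)\le\alpha\}$ with $\alpha\le f(\bar x)+\epsilon$ are closed. $f$ is relatively prox-regular at $\bar x\in\operatorname{int}(\operatorname{dom}\phi)$ for $\bar v$ if $f$ is finite and locally lsc at $\bar x$, $\bar v\in\partial f(\bar x)$, and there exist $\epsilon>0$, $r\ge0$ such that for all $\|x'-\bar x\|<\epsilon$, $\|x-\bar x\|<\epsilon$ (with $\epsilon$ sufficiently small that $x,x'\in\operatorname{int}(\operatorname{dom}\phi)$), $f(x')\ge f(x)+\langle v,x'-x\rangle-rD_\phi(x',x)$ whenever $f(x)-f(\bar x)<\epsilon$, $v\in\partial f(x)$, $\|v-\bar v\|<\epsilon$. *)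

(* Defs.v *)
From HB Require Import structures.
From mathcomp Require Import all_boot all_order all_algebra.
From mathcomp Require Import all_classical all_reals all_analysis.

Set Implicit Arguments.
Unset Strict Implicit.
Unset Printing Implicit Defensive.

Import Order.TTheory GRing.Theory Num.Theory.
Import numFieldNormedType.Exports.

Local Open Scope classical_set_scope.
Local Open Scope ring_scope.
Local Open Scope ereal_scope.

Section EuclideanSpace.
Context {R : realType} {m : nat}.
Implicit Types x y : 'rV[R]_m.

Definition dotp x y : R := (\sum_(i < m) x ord0 i * y ord0 i)%R.

(* The library norm of 'rV[R]_m is the max norm; it induces the same topology,
   so open sets, limits and differentiability are those of the library. *)
Definition enorm x : R := Num.sqrt (dotp x x).

End EuclideanSpace.

Section ExtendedRealFunctions.
Context {R : realType} {m : nat}.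
Local Notation V := 'rV[R]_m.
Implicit Types (f g phi : V -> \bar R) (x y v w : V).

Definition edom f : set V := [set x | f x < +oo].

Definition eproper f := (forall x, -oo < f x) /\ edom f !=set0.

(* For proper f no sum of opposite infinities occurs on the right-hand side,
   and 0 * +oo = 0 makes the cases t = 0 and t = 1 trivial. *)
Definition econvex f := forall x y (t : R), (0 <= t <= 1)%R ->
  f (t *: x + (1 - t) *: y)%R <= t%:E * f x + (1 - t)%:E * f y.

Definition Gamma0 f := [/\ eproper f, lower_semicontinuous f & econvex f].

(* An extended-real-valued function is differentiated through its real part;
   this is only meaningful at points around which it is finite. *)
Definition ediff f x := differentiable (fine \o f : V -> R^o) x.

Definition grad f x : V := \row_i ('D_(delta_mx ord0 i) (fine \o f : V -> R^o) x).

Definition hess f x : 'M[R]_m := jacobian (grad f) x.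

Definition fenchel_conj f y : \bar R := ereal_sup [set (dotp x y)%:E - f x | x in setT].

Definition regular_subdiff f x : set V := [set v | f x \is a fin_num /\
  forall e : R, (0 < e)%R -> \forall z \near x,
    f x + (dotp v (z - x))%:E - (e * enorm (z - x))%:E <= f z].

Definition limiting_subdiff f x : set V := [set v | f x \is a fin_num /\
  exists u w : nat -> V,
    [/\ u n @[n --> \oo] --> x,
        f (u n) @[n --> \oo] --> f x,
        (forall n, regular_subdiff f (u n) (w n)) &
        w n @[n --> \oo] --> v]].

Definition bdry (A : set V) : set V := closure A `\` interior A.

Definition essentially_smooth phi :=
  [/\ interior (edom phi) !=set0,
      (forall x, interior (edom phi) x -> ediff phi x) &
      (forall (u : nat -> V) x, (forall n, interior (edom phi) (u n)) ->
         u n @[n --> \oo] --> x -> bdry (edom phi) x ->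
         enorm (grad phi (u n)) @[n --> \oo] --> +oo%R)].

Definition strictly_convex_on (C : set V) f :=
  forall x y (t : R), C x -> C y -> x <> y -> (0 < t < 1)%R ->
    f (t *: x + (1 - t) *: y)%R < t%:E * f x + (1 - t)%:E * f y.

Definition essentially_strictly_convex phi :=
  forall C : set V, convex_set (C : set (convex_lmodType V)) ->
    C `<=` [set x | limiting_subdiff phi x !=set0] ->
    strictly_convex_on C phi.

Definition legendre phi :=
  essentially_smooth phi /\ essentially_strictly_convex phi.

Definition super_coercive phi :=
  forall A : R, exists M : R, forall x, (M < enorm x)%R ->
    A%:E < phi x * ((enorm x)^-1)%:E.

Definition C2_on (A : set V) f := forall x, A x ->
  [/\ ediff f x, differentiable (grad f) x & {for x, continuous (hess f)}].

Definition very_strictly_convex phi :=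
  [/\ interior (edom phi) !=set0,
      C2_on (interior (edom phi)) phi &
      (forall x w, interior (edom phi) x -> w <> 0%R ->
         (0 < dotp w (w *m hess phi x))%R)].

Definition bregman phi x y : \bar R :=
  if y \in (interior (edom phi) : set V) then
    phi x - phi y - (dotp (grad phi y) (x - y))%:E
  else +oo.

Definition argmin g : set V := [set x | forall z, g x <= g z].

Definition left_env phi (lam : R) f y : \bar R :=
  ereal_inf [set f x + (lam^-1)%:E * bregman phi x y | x in setT].

Definition left_prox phi (lam : R) f y : set V :=
  argmin (fun x => f x + (lam^-1)%:E * bregman phi x y).

Definition prox_bound_parameters phi f : set R := [set lam | (0 < lam)%R /\
  exists2 y, interior (edom phi) y & -oo < left_env phi lam f y].

Definition prox_bounded phi f := prox_bound_parameters phi f !=set0.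

Definition prox_threshold phi f : \bar R :=
  ereal_sup [set lam%:E | lam in prox_bound_parameters phi f].

Definition locally_lsc f x := f x \is a fin_num /\
  exists2 e : R, (0 < e)%R & forall a : \bar R, a <= f x + e%:E ->
    closed [set z | (enorm (z - x) <= e)%R /\ f z <= a].

Definition rel_prox_regular phi f xbar vbar :=
  [/\ interior (edom phi) xbar, locally_lsc f xbar,
      limiting_subdiff f xbar vbar &
      exists e r : R, [/\ (0 < e)%R, (0 <= r)%R,
        [set x | (enorm (x - xbar) < e)%R] `<=` interior (edom phi) &
        forall x' x v, (enorm (x' - xbar) < e)%R -> (enorm (x - xbar) < e)%R ->
          f x - f xbar < e%:E -> limiting_subdiff f x v ->
          (enorm (v - vbar) < e)%R ->
          f x + (dotp v (x' - x))%:E - r%:E * bregman phi x' x <= f x']].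

Definition C1_around g y := \forall z \near y,
  [/\ g z \is a fin_num, ediff g z & {for z, continuous (grad g)}].

Definition lipschitz_around (F : V -> V) y :=
  exists2 U : set V, nbhs y U & exists L : R, forall z z', U z -> U z' ->
    (enorm (F z - F z') <= L * enorm (z - z'))%R.

End ExtendedRealFunctions.

(* Main.v *)
Require Import Defs.
From HB Require Import structures.
From mathcomp Require Import all_boot all_order all_algebra.
From mathcomp Require Import all_classical all_reals all_analysis.
From mathcomp Require Import ring lra.
Set Implicit Arguments.
Unset Strict Implicit.
Unset Printing Implicit Defensive.
Import Order.TTheory GRing.Theory Num.Theory.
Import numFieldNormedType.Exports.
Local Open Scope classical_set_scope.
Local Open Scope ring_scope.

(** Write D(x, y) = phi(x) - phi(y) - <grad phi(y), x - y> and, for a slope z,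
    G_z(x) = lam f(x) + phi(x) - <z, x>.  If z = grad phi(y), then
    lam f(x) + D(x, y) differs from G_z(x) by a constant, namely the value at z
    of the conjugate of phi.  Hence, with g = phi + lam f,

      lam * env(grad (conj phi)(z)) = (conj phi)(z) - (conj g)(z),

    and the minimizers that define the proximal set at grad (conj phi)(z) are
    the minimizers of G_z.  A conjugate is differentiable, with the minimizer of
    the tilted function as gradient, as soon as this minimizer is unique and
    varies continuously with the slope [selection_has_grad].  So the theorem is
    about minimizers of G_z for z near the slope
    zbar = grad phi(xbar) + lam vbar; they are studied in
    [tilted_argmin_smooth], which also covers conj phi on taking f = 0
    [conjugate_smooth].

    At zbar itself, prox-boundedness turns the prox-regularity inequality at
    (xbar, vbar) into a global one, with a larger constant r'
    [prox_regular_minorant].  For lam r' < 1 it gives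
    G_zbar(x) - G_zbar(xbar) >= (1 - lam r') D(x, xbar), and D(x, xbar) grows at
    least linearly away from xbar [bregR_growth]; this survives a small change
    of slope, so that for z near zbar the minimizers of G_z exist and lie near
    xbar [tilted_far].  Such a minimizer p has (z - grad phi(p)) / lam as a
    subgradient of f, close to vbar because grad phi is continuous, and
    prox-regularity at p now yields G_z(x) - G_z(p) >= (1 - lam r') D(x, p) for
    x near xbar.  This proves uniqueness, and adding the inequalities for two
    slopes z, w with minimizers p, q gives

      (1 - lam r') <grad phi(q) - grad phi(p), q - p> <= <w - z, q - p>.

    Continuity of the minimizer follows by [bregR_growth] again.  If phi is very
    strictly convex, grad phi is strongly monotone near xbar
    [grad_strongly_monotone], and the same inequality makes the minimizer
    Lipschitz.

    As lam tends to 0, zbar tends to grad phi(xbar), the slope around which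
    [conjugate_smooth] describes conj phi.  For small lam both descriptions
    hold near zbar, and the points grad (conj phi)(z) and the proximal points
    all stay in one ball around xbar. *)

(** * Neighborhoods in terms of the norm *)

Section Near.
Context {R : realType} {W W' : normedModType R}.
Implicit Types (x y c : W) (e : R).

(** The neighborhood lemmas of this section are stated for arbitrary normed
    modules: on row vectors, unification would unfold the filter of
    neighborhoods into the product of the coordinate filters. *)
Lemma near_norm_lt x e : 0 < e -> \forall y \near x, `|y - x| < e.
Proof.
move=> e0; apply/nbhs_ballP; exists e => // y.
by rewrite -ball_normE /= distrC.
Qed.

Lemma near_norm_ball x c e : `|x - c| < e -> \forall y \near x, `|y - c| < e.
Proof.
move=> xc; have d0 : 0 < e - `|x - c| by rewrite subr_gt0.
apply: filterS (near_norm_lt x d0) => y yx; rewrite -(subrK x y) -addrA.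
by apply: le_lt_trans (ler_normD _ _) _; rewrite -ltrBrDr.
Qed.

Lemma near_ball_ex x (P : set W) :
  (\forall y \near x, P y) -> exists2 e : R, 0 < e & forall y, `|y - x| < e -> P y.
Proof.
move=> /nbhs_ballP[e e0 xeP]; exists e => // y yx; apply: xeP.
by rewrite -ball_normE /= distrC.
Qed.

Lemma near_interior (A : set W) x : interior A x -> \forall y \near x, interior A y.
Proof. by move=> Ax; apply: open_nbhs_nbhs; split=> //; exact: open_interior. Qed.

Lemma continuous_normP (h : W -> W') x : {for x, continuous h} <->
  forall e, 0 < e -> \forall y \near x, `|h y - h x| < e.
Proof.
split=> [/cvgrPdist_lt H e e0|H].
  by apply: filterS (H _ e0) => y; rewrite distrC.
by apply/cvgrPdist_lt => e e0; apply: filterS (H _ e0) => y; rewrite distrC.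
Qed.

Lemma near_continuous (g h : W -> W') x :
  (\forall w \near x, g w = h w) -> {for x, continuous h} -> {for x, continuous g}.
Proof.
move=> gh /continuous_normP hc; apply/continuous_normP => e e0.
have ghx := nbhs_singleton gh.
by near=> w; rewrite ghx (near gh w)//; near: w; exact: hc.
Unshelve. all: by end_near. Qed.

End Near.

(** * The pairing and its two norms *)

Section Pairing.
Context {R : realType} {m : nat}.
Local Notation V := 'rV[R]_m.
Implicit Types (x y z v w : V) (a e : R).

Lemma dotpC x y : dotp x y = dotp y x.
Proof. by apply: eq_bigr => i _; rewrite mulrC. Qed.

Lemma dotpDr x y z : dotp x (y + z) = dotp x y + dotp x z.
Proof. by rewrite -big_split; apply: eq_bigr => i _; rewrite mxE mulrDr. Qed.

Lemma dotpZr a x y : dotp x (a *: y) = a * dotp x y.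
Proof. by rewrite mulr_sumr; apply: eq_bigr => i _; rewrite mxE mulrCA. Qed.

Lemma dotpNr x y : dotp x (- y) = - dotp x y.
Proof. by rewrite -scaleN1r dotpZr mulN1r. Qed.

Lemma dotpBr x y z : dotp x (y - z) = dotp x y - dotp x z.
Proof. by rewrite dotpDr dotpNr. Qed.

Lemma dotpDl x y z : dotp (x + y) z = dotp x z + dotp y z.
Proof. by rewrite dotpC dotpDr !(dotpC z). Qed.

Lemma dotpZl a x y : dotp (a *: x) y = a * dotp x y.
Proof. by rewrite dotpC dotpZr dotpC. Qed.

Lemma dotpBl x y z : dotp (x - y) z = dotp x z - dotp y z.
Proof. by rewrite dotpC dotpBr !(dotpC z). Qed.

Lemma dotp0l x : dotp 0 x = 0.
Proof. by rewrite /dotp big1// => i _; rewrite mxE mul0r. Qed.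

Lemma dotp_delta x i : dotp x (delta_mx ord0 i) = x ord0 i.
Proof.
rewrite /dotp (bigD1 i)//= mxE !eqxx mulr1 big1 ?addr0// => j ji.
by rewrite mxE (negbTE ji) andbF mulr0.
Qed.

Lemma mx_coord_le_norm k n (A : 'M[R]_(k, n)) i j : `|A i j| <= `|A|.
Proof. by rewrite [leRHS]mx_normrE (le_bigmax _ _ (i, j)). Qed.

Lemma norm_rV_le x a : 0 <= a -> (forall i, `|x ord0 i| <= a) -> `|x| <= a.
Proof.
by move=> a0 xa; rewrite [leLHS]mx_normrE; apply: bigmax_le => // -[i j] _ /=; rewrite ord1.
Qed.

Lemma norm_delta_le (i : 'I_m) : `|delta_mx ord0 i : V| <= 1.
Proof.
by apply: norm_rV_le => // j; rewrite mxE; case: (_ && _); rewrite ?normr1 ?normr0.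
Qed.

Lemma ler_norm_dotp x y : `|dotp x y| <= m%:R * `|x| * `|y|.
Proof.
apply: le_trans (ler_norm_sum _ _ _) _.
have -> : m%:R * `|x| * `|y| = \sum_(i < m) `|x| * `|y|.
  by rewrite sumr_const card_ord -mulrA mulr_natl.
apply: ler_sum => i _.
by rewrite normrM ler_pM// mx_coord_le_norm.
Qed.

Lemma dotpxx_ge0 x : 0 <= dotp x x.
Proof. by apply: sumr_ge0 => i _; rewrite -expr2 sqr_ge0. Qed.

Lemma enorm_ge0 x : 0 <= enorm x. Proof. exact: sqrtr_ge0. Qed.

Lemma sqr_enorm x : enorm x ^+ 2 = dotp x x.
Proof. by rewrite sqr_sqrtr// dotpxx_ge0. Qed.

Lemma norm_le_enorm x : `|x| <= enorm x.
Proof.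
apply: norm_rV_le => [|i]; first exact: enorm_ge0.
rewrite -sqrtr_sqr ler_sqrt ?dotpxx_ge0// expr2 /dotp (bigD1 i)//= lerDl.
by apply: sumr_ge0 => j _; rewrite -expr2 sqr_ge0.
Qed.

Lemma enorm_le_norm x : enorm x <= m%:R * `|x|.
Proof.
rewrite -[leRHS]ger0_norm ?mulr_ge0// -sqrtr_sqr ler_sqrt ?sqr_ge0//.
apply: le_trans (ler_norm _) (le_trans (ler_norm_dotp x x) _).
rewrite exprMn -mulrA -expr2 ler_wpM2r ?sqr_ge0// -natrX ler_nat -mulnn.
by case: (m) => // n; rewrite leq_pmulr.
Qed.

End Pairing.

(** * Gradients of real functions *)

Section Gradient.
Context {R : realType} {m : nat}.
Local Notation V := 'rV[R]_m.
Implicit Types (A B : V -> R) (x y z c d v : V).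

(** The codomain is the regular module, as the library's differentials
    are linear maps into it. *)
Definition dotl c : V -> R^o := dotp c.

Fact dotl_linear c : linear (dotl c).
Proof. by move=> a x y; rewrite /dotl dotpDr dotpZr. Qed.

HB.instance Definition _ c := @GRing.isLinear.Build R V R^o _ (dotl c) (dotl_linear c).

Lemma dotp_continuous c : continuous (dotp c : V -> R).
Proof.
move=> x; apply/continuous_normP => e e0.
have M0 : 0 < m%:R * `|c| + 1 by rewrite ltr_wpDl// mulr_ge0.
near=> y; rewrite -dotpBr.
apply: le_lt_trans (ler_norm_dotp _ _) _.
apply: (@le_lt_trans _ _ ((m%:R * `|c| + 1) * `|y - x|)).
  by rewrite ler_wpM2r// lerDl.
rewrite mulrC -ltr_pdivlMr//; near: y.
by apply: (near_norm_lt (W := V)); rewrite divr_gt0.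
Unshelve. all: by end_near. Qed.

Lemma cvg_dotp (T : Type) (F : set_system T) (FF : Filter F) (h : T -> V) c v :
  h @ F --> v -> (fun t => dotp c (h t)) @ F --> (dotp c v : R).
Proof. by move=> hv; apply: cvg_comp hv _; exact: dotp_continuous. Qed.

(** First-order expansion with explicit constants, which handles extended-real
    functions through real expressions that agree with them locally.
    [has_gradP] and [ediff_has_grad] relate it to the library's differentials. *)
Definition has_grad A z c := forall e, 0 < e ->
  \forall x \near z, `|A x - A z - dotp c (x - z)| <= e * `|x - z|.

Lemma has_gradB A B z c d : has_grad A z c -> has_grad B z d ->
  has_grad (fun x => A x - B x) z (c - d).
Proof.
move=> Ac Bd e e0; have e20 : 0 < e / 2 by rewrite divr_gt0.
near=> x; rewrite dotpBl.
rewrite [X in `|X|](_ : _ = (A x - A z - dotp c (x - z)) - (B x - B z - dotp d (x - z)));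
  last by ring.
apply: le_trans (ler_normB _ _) _.
rewrite (splitr e) mulrDl lerD//; near: x; [exact: Ac|exact: Bd].
Unshelve. all: by end_near. Qed.

Lemma has_gradZ A z c k : has_grad A z c -> has_grad (fun x => k * A x) z (k *: c).
Proof.
move=> Ac e e0; have k0 : 0 < `|k| + 1 by rewrite ltr_wpDl.
near=> x; rewrite dotpZl -!mulrBr normrM.
apply: (@le_trans _ _ ((`|k| + 1) * (e / (`|k| + 1) * `|x - z|))).
  by rewrite ler_pM ?lerDl//; near: x; apply: Ac; rewrite divr_gt0.
by rewrite mulrA mulrCA divff ?mulr1 ?gt_eqF.
Unshelve. all: by end_near. Qed.

Lemma near_has_grad A B z c : (\forall x \near z, A x = B x) -> has_grad A z c ->
  has_grad B z c.
Proof.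
move=> AB Ac e e0; have ABz := nbhs_singleton AB.
near=> x; rewrite -ABz -(near AB x)//; near: x; exact: Ac.
Unshelve. all: by end_near. Qed.

Lemma has_gradP A z c : has_grad A z c ->
  differentiable (A : V -> R^o) z /\ 'd (A : V -> R^o) z = dotl c :> (V -> R^o).
Proof.
move=> Ac.
have cl : continuous (dotl c) by exact: dotp_continuous.
have E : (A : V -> R^o) \o shift z = cst (A z : R^o) + dotl c +o_ (0 : V) id.
  apply/eqaddoP => e e0.
  have := Ac _ e0; rewrite (near_shift 0) subr0; apply: filterS => x /=.
  rewrite -![(_ + _ : _ -> _) _]/(_ + _) -![(- _ : _ -> _) _]/(- _) /=.
  by rewrite -![(_ + _ : _ -> _) _]/(_ + _) addrK opprD addrA.
have dE := diff_unique cl E; split=> //.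
by apply/diff_locallyP; rewrite dE.
Qed.

Lemma has_grad_grad (f : V -> \bar R) z c : has_grad (fine \o f) z c -> grad f z = c.
Proof.
move=> /has_gradP[df dE]; apply/rowP => i; rewrite mxE deriveE// dE.
exact: dotp_delta.
Qed.

Lemma ediff_has_grad (f : V -> \bar R) z : ediff f z -> has_grad (fine \o f) z (grad f z).
Proof.
move=> df.
have dE v : 'd (fine \o f : V -> R^o) z v = dotp (grad f z) v.
  rewrite {1}(row_sum_delta v) linear_sum /dotp; apply: eq_bigr => i _.
  by rewrite linearZ /= -deriveE// mxE mulrC.
move=> e e0; have /diff_locally/eqaddoP/(_ _ e0) := df.
rewrite [X in _ -> X](near_shift 0) subr0; apply: filterS => x /=.
rewrite -![(_ + _ : _ -> _) _]/(_ + _) -![(- _ : _ -> _) _]/(- _) /=.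
by rewrite -![(_ + _ : _ -> _) _]/(_ + _) /cst opprD addrA dE addrK.
Qed.

(** The differentiability of a conjugate A in the form used below: w - z paired
    with the maximizer at z bounds the increment from below, and paired with the
    maximizer at w it bounds it from above, so that the two first-order terms
    differ by at most m |w - z| |p w - p z|. *)
Lemma selection_has_grad A (p : V -> V) z :
  (\forall w \near z, dotp (w - z) (p z) <= A w - A z <= dotp (w - z) (p w)) ->
  {for z, continuous p} -> has_grad A z (p z).
Proof.
move=> hA /continuous_normP pc e e0.
have M0 : (0 : R) < m%:R + 1 by rewrite ltr_wpDl.
near=> w.
have /andP[h1 h2] : dotp (w - z) (p z) <= A w - A z <= dotp (w - z) (p w) by near: w.
have pw : `|p w - p z| < e / (m%:R + 1) by near: w; apply: pc; rewrite divr_gt0.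
rewrite [dotp (p z) _]dotpC ger0_norm ?subr_ge0//.
apply: (@le_trans _ _ (dotp (w - z) (p w - p z))); first by rewrite dotpBr lerD2r.
apply: le_trans (ler_norm _) (le_trans (ler_norm_dotp _ _) _).
rewrite mulrAC ler_wpM2r//; move: pw; rewrite ltr_pdivlMr// => /ltW; apply: le_trans.
by rewrite mulrDr mulr1 mulrC lerDl.
Unshelve. all: by end_near. Qed.

End Gradient.

(** * Attainment of minima *)

Section LscMinimum.
Context {R : realType}.

Lemma ereal_between (a b : \bar R) : (a < b)%E -> exists2 c : R, (a < c%:E)%E & (c%:E < b)%E.
Proof.
case: a => [a| |]; case: b => [b| |] //=; rewrite ?lte_fin.
- move=> ab; exists ((a + b) / 2); rewrite lte_fin.
    by rewrite (midf_lt ab).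
  by rewrite (midf_lt ab).
- by move=> _; exists (a + 1); rewrite ?ltry// lte_fin ltrDl.
- by move=> _; exists (b - 1); rewrite ?ltNyr// lte_fin gtrBl.
- by move=> _; exists 0; rewrite ?ltry ?ltNyr.
Qed.

(** The nonempty sublevel sets at levels above the infimum generate a proper
    filter on K; at any of its cluster points, lower semicontinuity forbids a
    value above the infimum. *)
Lemma lsc_compact_min (T : topologicalType) (K : set T) (h : T -> \bar R) :
  K !=set0 -> compact K ->
  (forall x, K x -> forall a, (a%:E < h x)%E -> \forall y \near x, (a%:E < h y)%E) ->
  exists2 p, K p & forall x, K x -> (h p <= h x)%E.
Proof.
move=> [x0 Kx0] Kc hlsc.
pose al := ereal_inf (h @` K).
have alE x : K x -> (al <= h x)%E by move=> Kx; apply: ereal_inf_lbound; exists x.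
have [alfin|] := ltP al +oo%E; last first.
  rewrite leye_eq => /eqP aly; exists x0 => // x /alE.
  by rewrite aly leye_eq => /eqP ->; rewrite leey.
pose B (a : R) := [set x | K x /\ (h x < a%:E)%E].
have FF : ProperFilter (filter_from [set a : R | (al < a%:E)%E] B).
  apply: filter_from_proper.
    apply: filter_from_filter.
      by have [c ac _] := ereal_between alfin; exists c.
    move=> a b /= aa ab; exists (Num.min a b); first by rewrite EFin_min lt_min aa ab.
    by move=> x [Kx]; rewrite EFin_min lt_min => /andP[? ?]; split; split.
  by move=> a /= /ereal_inf_lt[_ [x Kx <-] xa]; exists x.
have [|p [Kp clp]] := Kc _ FF.
  by have [c ac _] := ereal_between alfin; exists c => // x [].
exists p => // x Kx; apply: le_trans (alE x Kx).
rewrite leNgt; apply/negP => /ereal_between[c ac cp].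
have [|y [[_ yc] cy]] := clp (B c) [set y | (c%:E < h y)%E] _ (hlsc _ Kp _ cp).
  by exists c.
by have := lt_trans yc cy; rewrite ltxx.
Qed.

Context {m : nat}.
Local Notation V := 'rV[R]_m.

Lemma near_lsc_add (f : V -> \bar R) (u : V -> R) (x : V) (a : R) :
  lower_semicontinuous f -> {for x, continuous u} ->
  (a%:E < f x + (u x)%:E)%E -> \forall y \near x, (a%:E < f y + (u y)%:E)%E.
Proof.
move=> flsc ucont axu.
have : ((a - u x)%:E < f x)%E.
  by rewrite EFinB; move: axu; case: (f x) => [b| |] //=; rewrite ?ltry// !lte_fin ltrBlDr.
move=> /ereal_between[c]; rewrite lte_fin => cax /flsc[U Ux fU].
have d0 : 0 < c + u x - a by lra.
near=> y.
have : (c%:E < f y)%E by apply: fU; near: y.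
have /ltr_normlP[+ _] : `|u y - u x| < c + u x - a.
  by near: y; exact: (proj1 (continuous_normP _ _) ucont).
by case: (f y) => [b| |] //=; rewrite ?ltry// !lte_fin; lra.
Unshelve. all: by end_near. Qed.

Lemma compact_norm_ball (y : V) (e : R) : 0 < e -> compact [set x : V | `|x - y| <= e].
Proof.
move=> e0; apply: bounded_closed_compact.
  exists (`|y| + e); split=> [|M hM x /= xy]; first exact: num_real.
  apply: le_trans (ltW hM); rewrite addrC -[x](subrK y).
  by apply: le_trans (ler_normD _ _) _; rewrite lerD2r.
have -> : [set x : V | `|x - y| <= e] = closed_ball y e.
  by rewrite closed_ballE//; apply/seteqP; split=> x /=; rewrite distrC.
exact: closed_ball_closed.
Qed.

Lemma compact_norm_sphere (y : V) (e : R) : 0 < e -> compact [set x : V | `|x - y| = e].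
Proof.
move=> e0.
have -> : [set x : V | `|x - y| = e] = [set x : V | `|x - y| <= e] `&` ~` ball y e.
  apply/seteqP; split=> x /=.
    move=> xy; split; first by rewrite xy.
    by rewrite -ball_normE /= distrC => yx; have : `|x - y| < e := yx; rewrite xy ltxx.
  move=> [xy yx]; apply/le_anti; rewrite xy /= leNgt; apply/negP => lt.
  by apply: yx; rewrite -ball_normE /= distrC.
by apply: compact_closedI; [exact: compact_norm_ball|apply: open_closedC; exact: ball_open].
Qed.

End LscMinimum.

(** * Bregman distances of convex functions *)

Section RegularSubgradients.
Context {R : realType} {m : nat}.
Local Notation V := 'rV[R]_m.

Lemma regular_limiting_subdiff (f : V -> \bar R) x v :
  regular_subdiff f x v -> limiting_subdiff f x v.
Proof.
move=> fv; split; first by case: fv.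
exists (fun=> x), (fun=> v); split=> //; exact: cvg_cst.
Qed.

End RegularSubgradients.

Section Bregman.
Context {R : realType} {m : nat}.
Local Notation V := 'rV[R]_m.

(** The real-valued [bregman], meaningful when phi is finite at both points and
    differentiable at y; see [bregman_edom]. *)
Definition bregR (phi : V -> \bar R) (x y : V) : R :=
  fine (phi x) - fine (phi y) - dotp (grad phi y) (x - y).

Lemma bregR_sym (phi : V -> \bar R) x y :
  bregR phi x y + bregR phi y x = dotp (grad phi x - grad phi y) (x - y).
Proof. by rewrite /bregR !(dotpBl, dotpBr); ring. Qed.

Lemma segmentE (x y : V) (t : R) : y + t *: (x - y) = t *: x + (1 - t) *: y.
Proof. by rewrite scalerBr scalerBl scale1r addrCA. Qed.

Lemma edom_fineK (f : V -> \bar R) : eproper f ->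
  forall x, edom f x -> (fine (f x))%:E = f x.
Proof. by move=> [fNy _] x fx; rewrite fineK// fin_numElt fNy. Qed.

Context {phi : V -> \bar R} (phi_proper : eproper phi) (phi_convex : econvex phi).
Context (phi_diff : forall x, interior (edom phi) x -> ediff phi x).

Local Notation P := (fine \o phi).
Local Notation D := (bregR phi).

Lemma interior_edom x : interior (edom phi) x -> edom phi x.
Proof. exact: interior_subset. Qed.

Lemma fine_convex x y (t : R) : edom phi x -> edom phi y -> 0 <= t <= 1 ->
  edom phi (y + t *: (x - y)) /\ P (y + t *: (x - y)) <= t * P x + (1 - t) * P y.
Proof.
move=> dx dy t01; rewrite segmentE; have := phi_convex x y t01.
rewrite -(edom_fineK phi_proper dx) -(edom_fineK phi_proper dy) -!EFinM -EFinD => h.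
have ds : edom phi (t *: x + (1 - t) *: y) by apply: le_lt_trans h (ltry _).
by split=> //; move: h; rewrite -(edom_fineK phi_proper ds) lee_fin.
Qed.

(** For fixed y the distance D(-, y) is convex and vanishes at y. *)
Lemma bregR_segment x y (t : R) : edom phi x -> edom phi y -> 0 <= t <= 1 ->
  D (y + t *: (x - y)) y <= t * D x y.
Proof.
move=> dx dy t01; have [_] := fine_convex dx dy t01.
by rewrite /bregR /= [y + _]addrC addrK dotpZr => h; lra.
Qed.

(** The gradient inequality.  Along the segment from y to x, D(-, y) is o(t) by
    differentiability but at most t D(x, y) by convexity. *)
Lemma bregR_ge0 x y : edom phi x -> interior (edom phi) y -> 0 <= D x y.
Proof.
move=> dx dy; apply/ler_addgt0Pr => e e0.
have d0 : 0 < `|x - y| + 1 by rewrite ltr_wpDl.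
have [r r0 hr] := near_ball_ex (ediff_has_grad (phi_diff dy) (divr_gt0 e0 d0)).
pose t := r / (`|x - y| + 1 + r).
have tr0 : 0 < `|x - y| + 1 + r by rewrite addr_gt0.
have t0 : 0 < t by rewrite divr_gt0.
have t1 : t <= 1 by rewrite ler_pdivrMr// mul1r lerDr ltW.
have tx : `|y + t *: (x - y) - y| = t * `|x - y|.
  by rewrite [y + _]addrC addrK normrZ gtr0_norm.
have tr : t * `|x - y| < r.
  by rewrite /t mulrAC ltr_pdivrMr// ltr_pM2l//; lra.
have := hr (y + t *: (x - y)); rewrite tx => /(_ tr).
rewrite -/(D (y + t *: (x - y)) y) => /ler_normlP[] /= hN _.
have hs : D (y + t *: (x - y)) y <= t * D x y.
  by apply: bregR_segment => //; [exact: interior_edom|rewrite ltW].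
have : 0 <= t * (D x y + e / (`|x - y| + 1) * `|x - y|) by rewrite mulrDr; lra.
rewrite pmulr_rge0// => h; apply: le_trans h _; rewrite lerD2l.
by rewrite mulrAC ler_pdivrMr// ler_wpM2l ?ltW// ltrDl.
Qed.

Lemma fine_continuous x : interior (edom phi) x -> {for x, continuous P}.
Proof. by move=> /phi_diff /differentiable_continuous. Qed.

Lemma bregR_continuous x y : interior (edom phi) x ->
  {for x, continuous (fun z => D z y)}.
Proof.
move=> dx; rewrite /bregR.
apply: (@continuousB _ _ _ (fun z => P z - P y) (fun z => dotp (grad phi y) (z - y))).
  by apply: continuousB; [exact: fine_continuous|exact: cst_continuous].
have -> : (fun z => dotp (grad phi y) (z - y)) =
  (fun z => dotp (grad phi y) z - dotp (grad phi y) y).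
  by apply/funext => z; rewrite dotpBr.
by apply: continuousB; [exact: dotp_continuous|exact: cst_continuous].
Qed.

(** A differentiable convex function is continuously differentiable: the slope
    of phi at y in the direction v is at most the difference quotient of phi at
    y with step h, which is continuous in y, and at y = x is close to the slope
    there once h is small. *)
Lemma grad_near (x v : V) (e : R) : interior (edom phi) x -> `|v| <= 1 -> 0 < e ->
  \forall y \near x, dotp (grad phi y - grad phi x) v <= e.
Proof.
move=> dx v1 e0; have e30 : 0 < e / 3 by rewrite divr_gt0.
have [r r0 hr] := near_ball_ex (ediff_has_grad (phi_diff dx) e30).
have [r' r'0 hr'] := near_ball_ex (near_interior dx).
(* Half of the radius r' leaves room for y + h *: v to stay in the interior when
   y is within h of x. *)
pose h := Num.min r r' / 2.
have rr0 : 0 < Num.min r r' by rewrite lt_min r0.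
have h0 : 0 < h by rewrite divr_gt0.
have hv : `|h *: v| <= h by rewrite normrZ gtr0_norm// ler_piMr// ltW.
have hmin : `|h *: v| < Num.min r r'.
  by apply: le_lt_trans hv _; rewrite /h ltr_pdivrMr// ltr_pMr// ltr1n.
have /andP[hvr hvr'] : (`|h *: v| < r) && (`|h *: v| < r') by rewrite -lt_min.
have xhvE : x + h *: v - x = h *: v by rewrite addrC addKr.
have dxh : interior (edom phi) (x + h *: v) by apply: hr'; rewrite xhvE.
have he0 : 0 < h * (e / 3) by rewrite mulr_gt0.
have [r1 r10 hr1] := near_ball_ex (proj1 (continuous_normP _ _) (fine_continuous dx) _ he0).
have [r2 r20 hr2] := near_ball_ex (proj1 (continuous_normP _ _) (fine_continuous dxh) _ he0).
near=> y.
have dy : interior (edom phi) y by near: y; exact: (near_interior (W := V)).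
have yx1 : `|y - x| < r1 by near: y; exact: (near_norm_lt (W := V)).
have yx2 : `|y - x| < r2 by near: y; exact: (near_norm_lt (W := V)).
have E1 : y + h *: v - (x + h *: v) = y - x by rewrite opprD addrACA subrr addr0.
have dyh : edom phi (y + h *: v).
  apply: interior_edom; apply: hr'; rewrite addrAC.
  apply: le_lt_trans (ler_normD _ _) _.
  have : `|y - x| < h by near: y; exact: (near_norm_lt (W := V)).
  have : Num.min r r' <= r' by rewrite ge_min lexx orbT.
  by move: hv; rewrite /h; lra.
have := bregR_ge0 dyh dy; rewrite /bregR [y + _ - y]addrC addKr dotpZr => k1.
have := hr (x + h *: v); rewrite xhvE => /(_ hvr) /ler_normlP[_ k2].
have := hr1 _ yx1 => /ltr_normlP[k3 _].
have := hr2 (y + h *: v); rewrite E1 => /(_ yx2) /ltr_normlP[_ k4].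
move: k1 k2 k3 k4; rewrite /= dotpZr => k1 k2 k3 k4.
have k5 : e / 3 * `|h *: v| <= h * (e / 3) by rewrite mulrC ler_wpM2r// ltW.
rewrite -(ler_pM2l h0) dotpBl mulrBr; lra.
Unshelve. all: by end_near. Qed.

Lemma grad_continuous x : interior (edom phi) x -> {for x, continuous (grad phi)}.
Proof.
move=> dx; apply/continuous_normP => e e0.
have e20 : 0 < e / 2 by rewrite divr_gt0.
have : \forall y \near x, forall i : 'I_m,
    dotp (grad phi y - grad phi x) (delta_mx ord0 i) <= e / 2 /\
    dotp (grad phi y - grad phi x) (- delta_mx ord0 i) <= e / 2.
  apply: (filter_forall (nbhs_filter (x : V))) => i.
  near=> y; split; near: y; apply: (grad_near dx) => //.
    by rewrite norm_delta_le.
  by rewrite normrN norm_delta_le.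
apply: filterS => y hy; apply: (@le_lt_trans _ _ (e / 2)); last by lra.
apply: norm_rV_le => [|i]; first exact: ltW.
by have [] := hy i; rewrite dotpNr dotp_delta => ? ?; apply/ler_normlP.
Unshelve. all: by end_near. Qed.

Lemma grad_regular_subdiff x : interior (edom phi) x -> regular_subdiff phi x (grad phi x).
Proof.
move=> dx; have xE := edom_fineK phi_proper (interior_edom dx).
split; first by rewrite -xE.
move=> e e0; near=> z; have dz : edom phi z.
  by apply: interior_edom; near: z; exact: (near_interior (W := V)).
rewrite -xE -(edom_fineK phi_proper dz) -EFinN -!EFinD lee_fin.
have := bregR_ge0 dz dx; have := mulr_ge0 (ltW e0) (enorm_ge0 (z - x)).
by rewrite /bregR; lra.
Unshelve. all: by end_near. Qed.

Context {xbar : V} {rho : R}.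
Context (ball_int : forall x, `|x - xbar| < rho -> interior (edom phi) x).
Context (phi_esc : essentially_strictly_convex phi).

(** Equality in the gradient inequality at x would force equality in the
    convexity inequality at the midpoint of x and y.  Essential strict convexity
    is applied to a ball, where phi has its gradient as a subgradient. *)
Lemma bregR_gt0 x y : `|x - xbar| < rho -> `|y - xbar| < rho -> x != y -> 0 < D x y.
Proof.
move=> hx hy xy.
have cvxB : convex_set (ball xbar rho : set (convex_lmodType V)).
  apply/convex_setW => z w; rewrite !inE -!ball_normE /= => hz hw l l0 l1.
  rewrite inE/=.
  rewrite [X in `|X|](_ : _ = l%:num *: (xbar - z) + (1 - l%:num) *: (xbar - w)); last first.
    by rewrite !scalerBr addrACA -scalerDl subrKC scale1r opprD.
  rewrite (le_lt_trans (ler_normD _ _))// !normrZ.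
  rewrite gtr0_norm// [`|1 - _|]gtr0_norm ?subr_gt0//.
  have -> : rho = l%:num * rho + (1 - l%:num) * rho by ring.
  by apply: ltrD; rewrite ltr_pM2l// subr_gt0.
have subB : ball xbar rho `<=` [set x | limiting_subdiff phi x !=set0].
  move=> z; rewrite -ball_normE /= distrC => /ball_int hz; exists (grad phi z).
  exact/regular_limiting_subdiff/grad_regular_subdiff.
have Bx : ball xbar rho x by rewrite -ball_normE /= distrC.
have By : ball xbar rho y by rewrite -ball_normE /= distrC.
have half01 : (0 < (2^-1 : R) < 1) by apply/andP; split; lra.
have := phi_esc cvxB subB Bx By (elimN eqP xy) half01.
have dx := interior_edom (ball_int hx).
have dy := interior_edom (ball_int hy).
have t01 : (0 <= (2^-1 : R) <= 1) by apply/andP; split; lra.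
have [ds _] := fine_convex dx dy t01.
have := bregR_ge0 ds (ball_int hy).
rewrite -segmentE -(edom_fineK phi_proper dx) -(edom_fineK phi_proper dy).
rewrite -(edom_fineK phi_proper ds) -!EFinM -EFinD lte_fin.
rewrite /bregR [_ + _ - y]addrC addKr dotpZr.
by lra.
Qed.

(** On a small sphere around y the distance D(-, y) has a positive minimum;
    by convexity it grows at least linearly beyond that sphere. *)
Lemma bregR_growth y (e : R) : `|y - xbar| < rho -> 0 < e ->
  exists2 eta : R, 0 < eta &
    forall x, edom phi x -> e <= `|x - y| -> eta * `|x - y| <= D x y.
Proof.
move=> hy e0.
pose e1 := Num.min e ((rho - `|y - xbar|) / 2).
have e10 : 0 < e1 by rewrite lt_min e0 divr_gt0// subr_gt0.
have e1e : e1 <= e by rewrite ge_min lexx.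
pose S := [set x : V | `|x - y| = e1].
have Sball x : S x -> `|x - xbar| < rho.
  rewrite /S /= => xy; rewrite -(subrK y x) -addrA.
  apply: le_lt_trans (ler_normD _ _) _; rewrite xy.
  have : e1 <= (rho - `|y - xbar|) / 2 by rewrite ge_min lexx orbT.
  by lra.
have [delta delta0 hdelta] : exists2 delta, 0 < delta & forall s, S s -> delta <= D s y.
  (* The sphere is empty in dimension 0. *)
  have [S0|S0] := pselect (S !=set0); last first.
    by exists 1 => // s Ss; case: S0; exists s.
  have Sc : compact S by exact: compact_norm_sphere.
  have [|c cS hc] := @compact_EVT_min _ _ (fun s => D s y) S S0 Sc.
    apply: continuous_in_subspaceT => s /set_mem Ss.
    by apply: bregR_continuous; apply: ball_int; exact: Sball.
  have {}cS := set_mem cS; exists (D c y); last by move=> s /mem_set; exact: hc.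
  apply: bregR_gt0 => //; first exact: Sball.
  by apply/eqP => cy; move: cS; rewrite /S /= cy subrr normr0; lra.
exists (delta / e1); first by rewrite divr_gt0.
move=> x dx xy; have nxy0 : 0 < `|x - y| by apply: lt_le_trans xy.
pose t := e1 / `|x - y|.
have t0 : 0 < t by rewrite divr_gt0.
have t1 : t <= 1 by rewrite ler_pdivrMr// mul1r (le_trans e1e).
have : delta <= t * D x y.
  apply: le_trans (bregR_segment dx (interior_edom (ball_int hy)) _); last by rewrite ltW.
  apply: hdelta; rewrite /S /= [y + _]addrC addrK normrZ gtr0_norm//.
  by rewrite /t divfK// gt_eqF.
by rewrite /t mulrAC ler_pdivlMr// mulrAC ler_pdivrMr// [D x y * e1]mulrC.
Qed.

(** If p w stayed at distance e from p z while w tends to z, the left-hand side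
    would be at least k eta |p w - p z| by [bregR_growth], whereas the right-hand
    side is at most m |w - z| |p w - p z|. *)
Lemma bregR_selection_continuous (p : V -> V) (N : set V) (k : R) (z : V) : 0 < k ->
  (forall w, N w -> `|p w - xbar| < rho) ->
  (forall w, N w -> k * (D (p w) (p z) + D (p z) (p w)) <= dotp (w - z) (p w - p z)) ->
  nbhs z N -> {for z, continuous p}.
Proof.
move=> k0 pB pD zN; apply/continuous_normP => e e0.
have Nz := nbhs_singleton zN.
have [eta eta0 growth] := bregR_growth (pB _ Nz) e0.
have M0 : (0 : R) < m%:R + 1 by rewrite ltr_wpDl.
near=> w.
have Nw : N w by near: w.
have wz : `|w - z| < k * eta / (m%:R + 1).
  by near: w; apply: (near_norm_lt (W := V)); rewrite divr_gt0// mulr_gt0.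
rewrite ltNge; apply/negP => ew.
have dw := interior_edom (ball_int (pB _ Nw)).
have dz := interior_edom (ball_int (pB _ Nz)).
have n0 : 0 < `|p w - p z| by apply: lt_le_trans ew.
have h1 := ler_wpM2l (ltW k0) (growth _ dw ew).
have h2 := mulr_ge0 (ltW k0) (bregR_ge0 dz (ball_int (pB _ Nw))).
have h3 := pD _ Nw.
have /ler_normlP[_ h4] := ler_norm_dotp (w - z) (p w - p z).
have h5 : m%:R * `|w - z| * `|p w - p z| < k * eta * `|p w - p z|.
  rewrite ltr_pM2r//; move: wz; rewrite ltr_pdivlMr//; apply: le_lt_trans.
  by rewrite mulrDr mulr1 mulrC lerDl.
have h6 : k * D (p w) (p z) <= dotp (w - z) (p w - p z).
  by move: h2 h3; lra.
have := le_lt_trans (le_trans h1 (le_trans h6 h4)) h5.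
by rewrite mulrA ltxx.
Unshelve. all: by end_near. Qed.

End Bregman.

(** * Minimizers of tilted functions *)

Section TiltedMinimization.
Context {R : realType} {m : nat}.
Local Notation V := 'rV[R]_m.

Definition tilted (phi f : V -> \bar R) (lam : R) (z x : V) : R :=
  lam * fine (f x) + fine (phi x) - dotp z x.

Context {phi : V -> \bar R} (phi_proper : eproper phi) (phi_convex : econvex phi).
Context (phi_diff : forall x, interior (edom phi) x -> ediff phi x).
Context (phi_esc : essentially_strictly_convex phi).
Context {xbar : V} {rho : R} (rho_gt0 : 0 < rho).
Context (ball_int : forall x, `|x - xbar| < rho -> interior (edom phi) x).
Context {f : V -> \bar R} (f_proper : eproper f) (f_lsc : lower_semicontinuous f).
Context (f_xbar : edom f xbar).
Context {lam : R} (lam_gt0 : 0 < lam).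

Local Notation P := (fine \o phi).
Local Notation F := (fine \o f).
Local Notation D := (bregR phi).
Local Notation G := (tilted phi f lam).

(** Fermat's rule: at a minimizer p of G_z, the differentiable part
    phi - <z, -> contributes exactly grad phi(p) - z. *)
Lemma tilted_min_regular_subdiff z p : edom f p -> interior (edom phi) p ->
  (forall x, edom f x -> edom phi x -> G z p <= G z x) ->
  regular_subdiff f p (lam^-1 *: (z - grad phi p)).
Proof.
move=> fp ip pmin; have pE := edom_fineK f_proper fp.
split; first by rewrite -pE.
move=> e e0; near=> x.
have dx : edom phi x.
  by apply: interior_edom; near: x; exact: (near_interior (W := V)).
have hx : `|P x - P p - dotp (grad phi p) (x - p)| <= lam * e * `|x - p|.
  by near: x; apply: (ediff_has_grad (phi_diff ip)); rewrite mulr_gt0.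
have [fx|] := ltP (f x) +oo%E; last by rewrite leye_eq => /eqP ->; rewrite leey.
have := pmin _ fx dx.
rewrite -pE -(edom_fineK f_proper fx) -EFinN -!EFinD lee_fin -(ler_pM2l lam_gt0).
rewrite dotpZl mulrBr mulrDr [lam * (_^-1 * _)]mulrA divff ?gt_eqF// mul1r.
move: hx => /ler_normlP[_].
have := ler_wpM2l (ltW (mulr_gt0 lam_gt0 e0)) (norm_le_enorm (x - p)).
by rewrite /tilted /= dotpBl !(dotpBr z); lra.
Unshelve. all: by end_near. Qed.

Context {vbar : V} {r : R} (lam_r : lam * r < 1).
Context (f_below : forall x, edom f x -> edom phi x ->
  F xbar + dotp vbar (x - xbar) - r * D x xbar <= F x).
(* Prox-regularity on the ball of radius rho; the separate radius e restricts
   the values of f and the subgradients that enter it. *)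
Context {e : R} (e_gt0 : 0 < e).
Context (f_prox_reg : forall p x v, `|p - xbar| < rho -> `|x - xbar| < rho ->
  edom f p -> edom f x -> F p < F xbar + e -> regular_subdiff f p v -> `|v - vbar| < e ->
  F p + dotp v (x - p) - r * D x p <= F x).

Local Notation zbar := (grad phi xbar + lam *: vbar).

(** The excess of G_z over its value at xbar is at least
    (1 - lam r) D(x, xbar) - <z - zbar, x - xbar>, and the first term dominates
    the second at distance eps or more when z is close to zbar. *)
Lemma tilted_far (eps : R) : 0 < eps -> exists2 delta : R, 0 < delta &
  forall z x, `|z - zbar| < delta -> edom f x -> edom phi x -> eps <= `|x - xbar| ->
    G z xbar < G z x.
Proof.
move=> eps0.
have xbarB : `|xbar - xbar| < rho by rewrite subrr normr0.
have [eta eta0 growth] := bregR_growth phi_proper phi_convex phi_diff ball_int phi_esc xbarB eps0.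
have k0 : 0 < 1 - lam * r by rewrite subr_gt0.
have M0 : (0 : R) < m%:R + 1 by rewrite ltr_wpDl.
exists ((1 - lam * r) * eta / (m%:R + 1)); first by rewrite divr_gt0// mulr_gt0.
move=> z x; rewrite ltr_pdivlMr// => hz fx dx ex.
have nx0 : 0 < `|x - xbar| by apply: lt_le_trans ex.
have h1 := ler_wpM2l (ltW lam_gt0) (f_below fx dx).
have h2 := ler_wpM2l (ltW k0) (growth _ dx ex).
have h3 : m%:R * `|z - zbar| * `|x - xbar| < (1 - lam * r) * eta * `|x - xbar|.
  rewrite ltr_pM2r//; apply: le_lt_trans hz.
  by rewrite mulrDr mulr1 mulrC lerDl.
have /ler_normlP[_ h4] := ler_norm_dotp (z - zbar) (x - xbar).
move: h1 h2 h3 h4; rewrite /tilted /bregR /= dotpBl dotpDl dotpZl !(dotpBr z) => h1 h2 h3 h4.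
by rewrite /bregR in h1 *; nra.
Qed.

(** A minimizer of G_z over a small closed ball around xbar is global and interior
    by [tilted_far].  It is so close to xbar that its value of f and its
    subgradient (z - grad phi(p)) / lam meet the conditions of
    prox-regularity, which then bounds the excess G_z - G_z(p) below by
    (1 - lam r) D(-, p). *)
Lemma tilted_argmin : exists2 delta : R, 0 < delta & exists p : V -> V,
  forall z, `|z - zbar| < delta ->
  [/\ edom f (p z), `|p z - xbar| < rho,
      (forall x, edom f x -> edom phi x -> x <> p z -> G z (p z) < G z x) &
      (forall x, edom f x -> `|x - xbar| < rho ->
        (1 - lam * r) * D x (p z) <= G z x - G z (p z))].
Proof.
have xbarB : `|xbar - xbar| < rho by rewrite subrr normr0.
have k0 : 0 < 1 - lam * r by rewrite subr_gt0.
have le0 : 0 < lam * e / 4 by rewrite divr_gt0// mulr_gt0.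
have M0 : (0 : R) < m%:R * (`|zbar| + 1) + 1 by rewrite ltr_wpDl// mulr_ge0// addr_ge0.
have ixbar := ball_int xbarB.
have [r1 r10 hr1] := near_ball_ex (proj1 (continuous_normP _ _)
  (fine_continuous phi_diff ixbar) _ le0).
have [r2 r20 hr2] := near_ball_ex (proj1 (continuous_normP _ _)
  (grad_continuous phi_proper phi_convex phi_diff ixbar) _ le0).
(* Within eps of xbar, phi and grad phi move by less than lam e / 4, and so does
   <z, -> for every z with |z| <= |zbar| + 1. *)
have [eps eps0 [er er1 er2 er3]] : exists2 eps : R, 0 < eps &
    [/\ eps < rho, eps < r1, eps < r2 & (m%:R * (`|zbar| + 1)) * eps < lam * e / 4].
  pose mm := Num.min (Num.min rho r1) (Num.min r2 (lam * e / 4 / (m%:R * (`|zbar| + 1) + 1))).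
  have mm0 : 0 < mm by rewrite !lt_min rho_gt0 r10 r20 divr_gt0.
  exists (mm / 2); first by rewrite divr_gt0.
  have : mm / 2 < mm by lra.
  rewrite {2}/mm !lt_min => /andP[/andP[-> ->] /andP[-> h]]; split=> //.
  move: h; rewrite ltr_pdivlMr// => h; apply: le_lt_trans h.
  by rewrite mulrC ler_wpM2l ?lerDl// ltW// divr_gt0.
have [d1 d10 far] := tilted_far eps0.
exists (Num.min (Num.min 1 d1) (lam * e / 4)); first by rewrite !lt_min ltr01 d10 le0.
suff H z : exists p, `|z - zbar| < Num.min (Num.min 1 d1) (lam * e / 4) ->
  [/\ edom f p, `|p - xbar| < rho,
      (forall x, edom f x -> edom phi x -> x <> p -> G z p < G z x) &
      (forall x, edom f x -> `|x - xbar| < rho ->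
        (1 - lam * r) * D x p <= G z x - G z p)].
  by have [p hp] := choice H; exists p.
have [|zN] := pselect (`|z - zbar| < Num.min (Num.min 1 d1) (lam * e / 4)); last first.
  by exists 0 => /zN.
rewrite !lt_min => /andP[/andP[z1 zd1] ze].
pose K := [set x : V | `|x - xbar| <= eps].
have Krho x : K x -> `|x - xbar| < rho by move=> /le_lt_trans; apply.
(* Dividing by lam leaves f itself with a continuous perturbation. *)
pose u x := lam^-1 * (P x - dotp z x).
have KK : compact K by exact: compact_norm_ball.
have [||p Kp pmin] := @lsc_compact_min R V K (fun x => f x + (u x)%:E)%E _ KK.
- by exists xbar; rewrite /K /= subrr normr0 ltW.
- move=> x Kx a; apply: near_lsc_add => //.
  apply: continuousM; first exact: cst_continuous.
  apply: continuousB; last exact: dotp_continuous.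
  by apply: (fine_continuous phi_diff); apply: ball_int; exact: Krho.
have Kxbar : K xbar by rewrite /K /= subrr normr0 ltW.
have fp : edom f p.
  have := pmin _ Kxbar; rewrite -(edom_fineK f_proper f_xbar) -EFinD /edom /=.
  by case: (f p) => [b| |] //=; rewrite ltry.
have GE x : lam * (F x + u x) = G z x.
  by rewrite /tilted /u mulrDr mulrA divff ?gt_eqF// mul1r addrA.
have pminK x : edom f x -> K x -> G z p <= G z x.
  move=> fx Kx; have := pmin _ Kx.
  rewrite -(edom_fineK f_proper fx) -(edom_fineK f_proper fp) -!EFinD lee_fin.
  by move=> h; rewrite -!GE ler_pM2l.
have peps : `|p - xbar| < eps.
  rewrite ltNge; apply/negP => pe.
  have := far z p zd1 fp (interior_edom (ball_int (Krho _ Kp))) pe.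
  by rewrite ltNge pminK.
have pminT x : edom f x -> edom phi x -> G z p <= G z x.
  move=> fx dx; have [xe|xe] := leP (`|x - xbar|) eps; first exact: pminK.
  by apply: ltW; apply: le_lt_trans (far z x zd1 fx dx (ltW xe)); exact: pminK.
have ip := ball_int (Krho _ Kp).
have vreg := tilted_min_regular_subdiff fp ip pminT.
pose v := lam^-1 *: (z - grad phi p).
have vvbar : `|v - vbar| < e.
  have -> : v - vbar = lam^-1 *: ((z - zbar) - (grad phi p - grad phi xbar)).
    rewrite /v !scalerBr !scalerDr scalerA mulVf ?gt_eqF// scale1r.
    by rewrite opprD !opprB; apply/rowP => i; rewrite !mxE; ring.
  rewrite normrZ gtr0_norm ?invr_gt0// mulrC ltr_pdivrMr//.
  apply: le_lt_trans (ler_normB _ _) _.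
  have h : `|grad phi p - grad phi xbar| < lam * e / 4 := hr2 _ (lt_trans peps er2).
  by apply: lt_trans (ltrD ze h) _; move: le0; lra.
have Fp : F p < F xbar + e.
  have := pminK _ f_xbar Kxbar.
  have /ltr_normlP[h1 _] := hr1 _ (lt_trans peps er1).
  have /ler_normlP[_ h2] := ler_norm_dotp z (p - xbar).
  have h3 : m%:R * `|z| * `|p - xbar| <= m%:R * (`|zbar| + 1) * eps.
    rewrite ler_pM ?mulr_ge0// ler_wpM2l// -(subrK zbar z); apply: le_trans (ler_normD _ _) _.
    by rewrite addrC lerD2l ltW.
  rewrite -(ltr_pM2l lam_gt0); move: h1 h2 h3 er3; rewrite /tilted /= dotpBr.
  by lra.
have prox x : edom f x -> `|x - xbar| < rho -> (1 - lam * r) * D x p <= G z x - G z p.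
  move=> fx xr.
  have := f_prox_reg (Krho _ Kp) xr fp fx Fp vreg vvbar.
  move=> /(ler_wpM2l (ltW lam_gt0)).
  rewrite mulrBr mulrDr dotpZl [lam * (_^-1 * _)]mulrA divff ?gt_eqF// mul1r.
  by rewrite /tilted /bregR /= dotpBl !(dotpBr z); lra.
exists p => _; split=> //; first exact: Krho.
move=> x fx dx xp; have [xr|xr] := ltP (`|x - xbar|) rho.
  have := prox x fx xr.
  have := bregR_gt0 phi_proper phi_convex phi_diff ball_int phi_esc xr (Krho _ Kp) (introN eqP xp).
  by move=> /(mulr_gt0 k0); lra.
by apply: le_lt_trans (far z x zd1 fx dx (ltW (lt_le_trans er xr))); exact: pminK.
Qed.

(** The function w |-> - G_w (p w) is the conjugate of phi + lam f, so its gradient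
    is the minimizer itself. *)
Lemma tilted_argmin_smooth : exists2 delta : R, 0 < delta & exists p : V -> V,
  forall z, `|z - zbar| < delta ->
  [/\ edom f (p z) /\ `|p z - xbar| < rho,
      (forall x, edom f x -> edom phi x -> x <> p z -> G z (p z) < G z x),
      (forall w, `|w - zbar| < delta ->
        (1 - lam * r) * dotp (grad phi (p w) - grad phi (p z)) (p w - p z) <=
          dotp (w - z) (p w - p z)),
      {for z, continuous p} &
      has_grad (fun w => - G w (p w)) z (p z)].
Proof.
have [delta delta0 [p hp]] := tilted_argmin; exists delta => //; exists p.
pose N := [set z : V | `|z - zbar| < delta].
have nbN z : N z -> nbhs z N.
  exact: (near_norm_ball (W := V)).
(* Add the excess inequality at z, taken at p w, to the one at w, taken at p z. *)
have mono z w : N z -> N w ->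
    (1 - lam * r) * (D (p w) (p z) + D (p z) (p w)) <= dotp (w - z) (p w - p z).
  move=> Nz Nw; have [fz Bz _ hz] := hp z Nz; have [fw Bw _ hw] := hp w Nw.
  have := hz _ fw Bw; have := hw _ fz Bz.
  by rewrite /tilted dotpBl !dotpBr; lra.
have pc z : N z -> {for z, continuous p}.
  move=> Nz; apply: (bregR_selection_continuous phi_proper phi_convex phi_diff ball_int
    phi_esc (N := N) (k := 1 - lam * r)); first by rewrite subr_gt0.
  - by move=> w /hp[].
  - by move=> w Nw; exact: mono.
  - exact: nbN.
have minp z x : N z -> edom f x -> edom phi x -> G z (p z) <= G z x.
  move=> /hp[_ _ + _] fx dx; have [->//|/eqP xp hz] := eqVneq x (p z).
  by rewrite ltW// hz.
have dp z : N z -> edom phi (p z) by move=> /hp[_ Bz _ _]; exact/interior_edom/ball_int.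
move=> z Nz; have [fz Bz hz _] := hp z Nz; split=> //.
- by move=> w Nw; have := mono z w Nz Nw; rewrite bregR_sym.
- exact: pc.
- apply: selection_has_grad; last exact: pc.
  apply: filterS (nbN z Nz) => w Nw; have [fw _ _ _] := hp w Nw.
  have := minp z (p w) Nz fw (dp _ Nw); have := minp w (p z) Nw fz (dp _ Nz).
  by rewrite /tilted !dotpBl => h1 h2; apply/andP; split; lra.
Qed.

End TiltedMinimization.

(** * Strong monotonicity of the gradient *)

Section StrongMonotonicity.
Context {R : realType} {m : nat}.
Local Notation V := 'rV[R]_m.

Lemma norm_mulmx_le (w : V) (A : 'M[R]_m) : `|w *m A| <= m%:R * `|w| * `|A|.
Proof.
apply: norm_rV_le => [|i]; first by rewrite !mulr_ge0.
rewrite mxE; apply: le_trans (ler_norm_sum _ _ _) _.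
have -> : m%:R * `|w| * `|A| = \sum_(j < m) `|w| * `|A|.
  by rewrite sumr_const card_ord -mulrA mulr_natl.
by apply: ler_sum => j _; rewrite normrM ler_pM// mx_coord_le_norm.
Qed.

Lemma quadratic_continuous (A : 'M[R]_m) : continuous (fun w : V => dotp w (w *m A)).
Proof.
have coordc i : continuous (fun w : V => w ord0 i) by move=> w; exact: coord_continuous.
have sumc n (g : 'I_n -> V -> R) : (forall i, continuous (g i)) ->
    continuous (fun w => \sum_(i < n) g i w).
  move=> gc w; elim: n g gc => [|n IH] g gc.
    rewrite (_ : (fun w => _) = cst 0); first exact: cst_continuous.
    by apply/funext => v; rewrite big_ord0.
  rewrite (_ : (fun w => _) = (fun w => \sum_(i < n) g (widen_ord (leqnSn n) i) w + g ord_max w)).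
    by apply: continuousD; [exact: IH|exact: gc].
  by apply/funext => v; rewrite big_ord_recr.
apply: (sumc m) => i w; apply: continuousM; first exact: coordc.
rewrite (_ : (fun w => _) = (fun w : V => \sum_j w ord0 j * A j i)).
  by apply: sumc => j v; apply: continuousM; [exact: coordc|exact: cst_continuous].
by apply/funext => v; rewrite mxE.
Qed.

(** The quadratic form has a positive minimum on the unit sphere; the general case
    follows by homogeneity. *)
Lemma quadratic_coercive (A : 'M[R]_m) :
  (forall w : V, w <> 0 -> 0 < dotp w (w *m A)) ->
  exists2 s : R, 0 < s & forall w : V, s * `|w| ^+ 2 <= dotp w (w *m A).
Proof.
move=> Apos; pose S := [set w : V | `|w - 0| = 1].
have [s s0 hs] : exists2 s, 0 < s & forall w, S w -> s <= dotp w (w *m A).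
  have [S0|S0] := pselect (S !=set0); last first.
    by exists 1 => // w Sw; case: S0; exists w.
  have Sc : compact S by exact: compact_norm_sphere.
  have [|c cS hc] := @compact_EVT_min _ _ (fun w => dotp w (w *m A)) S S0 Sc.
    by apply: continuous_in_subspaceT => w _; exact: quadratic_continuous.
  exists (dotp c (c *m A)); last by move=> w /mem_set; exact: hc.
  apply: Apos => c0; have := set_mem cS.
  by rewrite /S /= c0 subrr normr0 => /esym/eqP; rewrite oner_eq0.
exists s => // w; have [->|w0] := eqVneq w 0.
  by rewrite normr0 expr0n mulr0 dotp0l.
have n0 : 0 < `|w| by rewrite normr_gt0.
have := hs (`|w|^-1 *: w); rewrite /S /= subr0 normrZ normfV normr_id mulVf ?gt_eqF//.
move=> /(_ erefl); rewrite -scalemxAl dotpZl dotpZr.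
rewrite mulrA -expr2 -(ler_pM2r (exprn_gt0 2 n0)) mulrAC exprVn.
by rewrite mulVf ?mul1r// expf_neq0// gt_eqF.
Qed.

Lemma unit_mean_value (g g' : R -> R) :
  (forall t : R, t \in `[0, 1] -> is_derive t (1 : R) g (g' t)) ->
  exists2 c : R, c \in `[0, 1] & g 1 - g 0 = g' c.
Proof.
move=> dg.
have dg' (t : R) : t \in `]0, 1[ -> is_derive t (1 : R) g (g' t).
  by rewrite in_itv/= => /andP[t0 t1]; apply: dg; rewrite in_itv/= !ltW.
have gc : {within `[0, 1], continuous g}.
  apply: continuous_in_subspaceT => t /set_mem /dg[gd _].
  by apply: differentiable_continuous; exact/derivable1_diffP.
have [c c01] := MVT_segment ler01 dg' gc.
by rewrite subr0 mulr1; exists c.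
Qed.

(** Close to xbar the Hessian form keeps half of its lower bound at xbar, by
    continuity; the mean value theorem along the segment from y to x transfers
    the bound to the increments of the gradient. *)
Lemma grad_strongly_monotone (phi : V -> \bar R) (xbar : V) :
  interior (edom phi) xbar -> very_strictly_convex phi ->
  exists2 rho : R, 0 < rho & exists2 s : R, 0 < s &
    forall x y, `|x - xbar| < rho -> `|y - xbar| < rho ->
      s * `|x - y| ^+ 2 <= dotp (grad phi x - grad phi y) (x - y).
Proof.
move=> ixbar [_ phiC2 hess_pos].
have [s s0 hs] := quadratic_coercive (fun w => hess_pos xbar w ixbar).
have s20 : 0 < s / 2 by rewrite divr_gt0.
have M0 : (0 : R) < m%:R * m%:R + 1 by rewrite ltr_wpDl// mulr_ge0.
have [_ _ /continuous_normP hessc] := phiC2 _ ixbar.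
have [r1 r10 hr1] := near_ball_ex (hessc _ (divr_gt0 s20 M0)).
have [r2 r20 hr2] := near_ball_ex (near_interior ixbar).
exists (Num.min r1 r2); first by rewrite lt_min r10.
exists (s / 2) => // x y hx hy; set d := x - y.
have seg t : t \in `[0, 1] -> `|y + t *: d - xbar| < Num.min r1 r2.
  rewrite in_itv /= => /andP[t0 t1].
  have -> : y + t *: d - xbar = t *: (x - xbar) + (1 - t) *: (y - xbar).
    by rewrite /d; apply/rowP => i; rewrite !mxE; ring.
  apply: le_lt_trans (ler_normD _ _) _; rewrite !normrZ ger0_norm//.
  rewrite ger0_norm ?subr_ge0//.
  apply: (@le_lt_trans _ _ (Num.max `|x - xbar| `|y - xbar|)); last by rewrite gt_max hx.
  set c := Num.max _ _.
  have xc : `|x - xbar| <= c by rewrite le_max lexx.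
  have yc : `|y - xbar| <= c by rewrite le_max lexx orbT.
  have -> : c = t * c + (1 - t) * c by ring.
  by apply: lerD; rewrite ler_wpM2l// subr_ge0.
pose g t := dotp d (grad phi (y + t *: d)).
have dg (t : R) : t \in `[0, 1] -> is_derive t (1 : R) g (dotp d (d *m hess phi (y + t *: d))).
  move=> /seg; rewrite lt_min => /andP[_ /hr2 ip].
  have [_ dgrad _] := phiC2 _ ip.
  suff H : (fun h : R => h^-1 *: ((g \o shift t) (h *: (1 : R)) - g t)) @ 0^' -->
      dotp d (d *m hess phi (y + t *: d)).
    by split; [apply/cvg_ex; eexists; exact: H|exact/cvg_lim].
  have Hd : (fun h : R => h^-1 *:
      ((grad phi \o shift (y + t *: d)) (h *: d) - grad phi (y + t *: d)))
      @ 0^' --> d *m hess phi (y + t *: d).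
    by rewrite /hess -deriveEjacobian//; exact: (diff_derivable dgrad).
  rewrite (_ : (fun h : R => _) = (fun h : R => dotp d (h^-1 *:
      ((grad phi \o shift (y + t *: d)) (h *: d) - grad phi (y + t *: d))))).
    exact: cvg_dotp Hd.
  apply/funext => h; rewrite [RHS]dotpZr dotpBr /g /=.
  by rewrite -[h *: 1]/(h * 1) mulr1 scalerDl addrCA.
have [c c01] := unit_mean_value dg.
rewrite /g scale1r scale0r addr0 /d subrKC -/d -dotpBr dotpC => ->.
have := seg c c01; rewrite lt_min => /andP[/hr1 hessd _].
set H := hess phi _ in hessd *.
have -> : dotp d (d *m H) = dotp d (d *m hess phi xbar) + dotp d (d *m (H - hess phi xbar)).
  by rewrite -dotpDr -mulmxDr subrKC.
have h1 := hs d.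
have /ler_normlP[h2 _] := ler_norm_dotp d (d *m (H - hess phi xbar)).
have h3 : m%:R * `|d| * `|d *m (H - hess phi xbar)| <= s / 2 * `|d| ^+ 2.
  apply: (@le_trans _ _ (m%:R * `|d| * (m%:R * `|d| * `|H - hess phi xbar|))).
    by rewrite ler_wpM2l ?mulr_ge0// norm_mulmx_le.
  set k := `|H - _|.
  have -> : m%:R * `|d| * (m%:R * `|d| * k) = m%:R * m%:R * k * `|d| ^+ 2 by ring.
  rewrite ler_wpM2r ?sqr_ge0//.
  move: hessd; rewrite -/k ltr_pdivlMr// => /ltW; apply: le_trans.
  by rewrite mulrDr mulr1 mulrC lerDl /k.
have := le_trans h2 h3; move: h1; lra.
Qed.

(** Dividing by the norm of d: here d is the displacement of a minimizer and u that
    of the slope. *)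
Lemma strongly_monotone_lipschitz (k : R) (u d : V) : 0 < k ->
  k * `|d| ^+ 2 <= dotp u d -> `|d| <= m%:R / k * `|u|.
Proof.
move=> k0 h; have [->|d0] := eqVneq d 0; first by rewrite normr0 !mulr_ge0// invr_ge0 ltW.
have n0 : 0 < `|d| by rewrite normr_gt0.
have := le_trans h (le_trans (ler_norm _) (ler_norm_dotp u d)).
by rewrite expr2 mulrA ler_pM2r// mulrAC ler_pdivlMr// mulrC.
Qed.

End StrongMonotonicity.

(** * Envelopes and conjugates at attained minima *)

Section Envelopes.
Context {R : realType} {m : nat}.
Local Notation V := 'rV[R]_m.

(** Testing along x + t v with slope error |v| / (m + 1): there
    t |v|^2 <= t <v, v> would have to be at most (m / (m + 1)) t |v|^2. *)
Lemma regular_subdiff_cst0 (x v : V) : regular_subdiff (fun=> 0%E : \bar R) x v -> v = 0.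
Proof.
move=> [_ hv]; apply/eqP; rewrite -normr_eq0; apply/negPn/negP => v0.
have n0 : 0 < `|v| by rewrite lt_neqAle eq_sym v0 normr_ge0.
have M0 : (0 : R) < m%:R + 1 by rewrite ltr_wpDl.
have [d d0 hd] := near_ball_ex (hv _ (divr_gt0 n0 M0)).
pose t := d / (`|v| * 2); have t0 : 0 < t by rewrite divr_gt0// mulr_gt0.
have tvd : `|t *: v| < d.
  by rewrite normrZ gtr0_norm// /t invfM mulrA mulrAC divfK ?gt_eqF//; lra.
have := hd (x + t *: v); rewrite [x + _]addrC addrK => /(_ tvd).
rewrite add0e -EFinB lee_fin dotpZr -sqr_enorm => h1.
have h2 := ler_wpM2l (ltW (divr_gt0 n0 M0)) (enorm_le_norm (t *: v)).
have h3 : `|v| ^+ 2 <= enorm v ^+ 2 by rewrite lerXn2r ?nnegrE// ?enorm_ge0 ?norm_le_enorm.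
have h4 := ler_wpM2l (ltW t0) h3.
have : t * `|v| ^+ 2 <= `|v| / (m%:R + 1) * (m%:R * `|t *: v|).
  by apply: le_trans h4 _; apply: le_trans h2; rewrite -subr_le0.
rewrite normrZ gtr0_norm// (_ : _ * (_ * (t * `|v|)) =
  m%:R / (m%:R + 1) * (t * `|v| ^+ 2)); last by ring.
rewrite leNgt gtr_pMl ?(mulr_gt0 t0) ?exprn_gt0//.
by rewrite ltr_pdivrMr// mul1r ltrDl ltr01.
Qed.

Context {phi : V -> \bar R} (phi_proper : eproper phi).

Lemma fenchel_conj_attained (z q : V) : edom phi q ->
  (forall x, edom phi x -> fine (phi q) - dotp z q <= fine (phi x) - dotp z x) ->
  fenchel_conj phi z = (dotp z q - fine (phi q))%:E.
Proof.
move=> dq qmin; apply/le_anti/andP; split; last first.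
  by apply: ereal_sup_ubound; exists q => //; rewrite dotpC EFinB (edom_fineK phi_proper dq).
apply: ge_ereal_sup => _ [x _ <-].
have [dx|] := ltP (phi x) +oo%E; last by rewrite leye_eq => /eqP ->; rewrite leNye.
by rewrite -(edom_fineK phi_proper dx) -EFinB lee_fin [dotp x z]dotpC; have := qmin x dx; lra.
Qed.

Context {f : V -> \bar R} (f_proper : eproper f).
Context {lam : R} (lam_gt0 : 0 < lam).
Context {y : V} (iy : interior (edom phi) y).

Local Notation G := (tilted phi f lam (grad phi y)).
Local Notation E x := (f x + (lam^-1)%:E * bregman phi x y)%E.
Local Notation conj_value := (dotp (grad phi y) y - fine (phi y)).

Lemma bregman_edom x : edom phi x -> bregman phi x y = (bregR phi x y)%:E.
Proof.
move=> dx; rewrite /bregman mem_set//.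
by rewrite -(edom_fineK phi_proper dx) -(edom_fineK phi_proper (interior_edom iy)).
Qed.

(** The envelope's objective at y is an affine function of the tilted function of
    slope grad phi(y); the constant is the conjugate of phi at that slope. *)
Lemma env_objective_fin x : edom f x -> edom phi x ->
  E x = (lam^-1 * (G x + conj_value))%:E.
Proof.
move=> fx dx; rewrite bregman_edom// -(edom_fineK f_proper fx) -EFinM -EFinD.
congr (_%:E); apply: (mulfI (lt0r_neq0 lam_gt0)).
rewrite mulrDr !mulrA divff ?lt0r_neq0// !mul1r.
by rewrite /tilted /bregR dotpBr; ring.
Qed.

Lemma env_objective_infty x : ~ (edom f x /\ edom phi x) -> E x = +oo%E.
Proof.
move=> nfx; have [dx|] := ltP (phi x) +oo%E.
  rewrite bregman_edom// -EFinM; have [fx|] := ltP (f x) +oo%E; first by case: nfx.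
  by rewrite leye_eq => /eqP ->.
rewrite leye_eq => /eqP phix; rewrite /bregman mem_set// phix.
rewrite -(edom_fineK phi_proper (interior_edom iy)) /=.
rewrite gt0_muley ?lte_fin ?invr_gt0// addey//.
by case: f_proper => + _ => /(_ x); rewrite ltNye.
Qed.

Lemma left_env_prox_unique p : edom f p -> edom phi p ->
  (forall x, edom f x -> edom phi x -> x <> p -> G p < G x) ->
  left_env phi lam f y = (lam^-1 * (G p + conj_value))%:E /\
  left_prox phi lam f y = [set p].
Proof.
move=> fp dp pmin.
have Emin x : x <> p -> (E p < E x)%E.
  move=> xp; have [[fx dx]|nx] := pselect (edom f x /\ edom phi x).
    by rewrite !env_objective_fin// lte_fin ltr_pM2l ?invr_gt0// ltrD2r pmin.
  by rewrite (env_objective_infty nx) env_objective_fin// ltry.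
have Emin_le x : (E p <= E x)%E.
  by have [->//|/eqP xp] := eqVneq x p; exact/ltW/Emin.
split.
  rewrite -env_objective_fin//; apply/le_anti/andP; split.
    by apply: ereal_inf_lbound; exists p.
  by apply: le_ereal_inf_tmp => _ [x _ <-]; exact: Emin_le.
apply/seteqP; split=> [x xmin|_ ->]; last exact: Emin_le.
apply: contrapT => /Emin; rewrite ltNge => /negP; apply; exact: xmin.
Qed.

End Envelopes.

(** * A global minorant from prox-boundedness *)

Section GlobalMinorant.
Context {R : realType} {m : nat}.
Local Notation V := 'rV[R]_m.
Context {phi : V -> \bar R} (phi_proper : eproper phi) (phi_convex : econvex phi).
Context (phi_diff : forall x, interior (edom phi) x -> ediff phi x).
Context (phi_esc : essentially_strictly_convex phi).
Context {f : V -> \bar R} (f_proper : eproper f).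

Local Notation P := (fine \o phi).
Local Notation F := (fine \o f).
Local Notation D := (bregR phi).

Lemma prox_bounded_minorant : prox_bounded phi f ->
  exists (mu c : R) (y0 : V), 0 < mu /\
    forall x, edom f x -> edom phi x -> c - mu * D x y0 <= F x.
Proof.
move=> [mu [mu0 [y0 iy0 /ereal_between[c _ cenv]]]].
exists mu^-1, c, y0; split; first by rewrite invr_gt0.
move=> x fx dx; rewrite lerBlDr -lee_fin EFinD EFinM (edom_fineK f_proper fx).
rewrite -(bregman_edom phi_proper iy0 dx); apply: le_trans (ltW cenv) _.
by apply: ereal_inf_lbound; exists x.
Qed.

(** Within rho of xbar this is the hypothesis.  Beyond, prox-boundedness bounds f
    below by - mu D(x, y0), which is - mu D(x, xbar) up to an affine function of x;
    and there D(x, xbar) dominates both constants and |x - xbar|. *)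
Lemma prox_regular_minorant (xbar vbar : V) (rho r : R) :
  0 < rho -> (forall x, `|x - xbar| < rho -> interior (edom phi) x) ->
  prox_bounded phi f ->
  (forall x, edom f x -> `|x - xbar| < rho ->
    F xbar + dotp vbar (x - xbar) - r * D x xbar <= F x) ->
  exists2 r' : R, r <= r' & forall x, edom f x -> edom phi x ->
    F xbar + dotp vbar (x - xbar) - r' * D x xbar <= F x.
Proof.
move=> rho0 ball_int /prox_bounded_minorant[mu [c [y0 [mu0 minor]]]] loc.
have xbarB : `|xbar - xbar| < rho by rewrite subrr normr0.
have ixbar := ball_int _ xbarB.
have [eta eta0 growth] := bregR_growth phi_proper phi_convex phi_diff ball_int phi_esc xbarB rho0.
(* A and w are the constant and linear parts of the affine function. *)
pose w := mu *: (grad phi xbar - grad phi y0) + vbar.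
pose A := `|F xbar - c + mu * (P xbar - P y0 - dotp (grad phi y0) (xbar - y0))|.
pose r1 := mu + A / (rho * eta) + m%:R * `|w| / eta.
exists (Num.max r r1); first by rewrite le_max lexx.
move=> x fx dx; have Dge0 := bregR_ge0 phi_proper phi_convex phi_diff dx ixbar.
have rle a : a <= Num.max r r1 -> F xbar + dotp vbar (x - xbar) - a * D x xbar <= F x ->
    F xbar + dotp vbar (x - xbar) - Num.max r r1 * D x xbar <= F x.
  by move=> ar h; apply: le_trans h; rewrite lerD2l lerN2 ler_wpM2r.
have [xr|xr] := ltP `|x - xbar| rho; first by apply: (rle r); [rewrite le_max lexx|exact: loc].
apply: (rle r1); first by rewrite le_max lexx orbT.
have h1 := growth x dx xr.
have A0 : 0 <= A := normr_ge0 _.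
have h2 : A <= A / (rho * eta) * D x xbar.
  rewrite mulrAC ler_pdivlMr ?mulr_gt0// ler_wpM2l//.
  by apply: le_trans h1; rewrite mulrC ler_wpM2l// ltW.
have h3 : m%:R * `|w| * `|x - xbar| <= m%:R * `|w| / eta * D x xbar.
  rewrite -[leRHS]mulrA ler_wpM2l ?mulr_ge0// ler_pdivlMl//; exact: h1.
have h4 := le_trans (le_trans (ler_norm _) (ler_norm_dotp w (x - xbar))) h3.
have h5 := le_trans (ler_norm _ : _ <= A) h2.
have := minor x fx dx; move: h4 h5; rewrite /w dotpDl dotpZl /r1.
have -> : D x y0 = D x xbar + (P xbar - P y0 - dotp (grad phi y0) (xbar - y0)) +
    dotp (grad phi xbar - grad phi y0) (x - xbar).
  by rewrite /bregR /= !dotpBl !dotpBr; ring.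
by rewrite [(mu + _ + _) * _]mulrDl [(mu + _) * _]mulrDl; lra.
Qed.

End GlobalMinorant.

(** * Differentiability of the envelope *)

Section ProxRegularity.
Context {R : realType} {m : nat}.
Local Notation V := 'rV[R]_m.

(** Shrinking the radius by m + 1 replaces Euclidean balls by balls of the maximum
    norm. *)
Lemma rel_prox_regular_ball (phi f : V -> \bar R) (xbar vbar : V) :
  eproper phi -> eproper f -> rel_prox_regular phi f xbar vbar ->
  exists (e r : R), [/\ 0 < e, 0 <= r,
    (forall x, `|x - xbar| < e -> interior (edom phi) x) &
    forall p x v, `|p - xbar| < e -> `|x - xbar| < e -> edom f p -> edom f x ->
      fine (f p) < fine (f xbar) + e -> limiting_subdiff f p v -> `|v - vbar| < e ->
      fine (f p) + dotp v (x - p) - r * bregR phi x p <= fine (f x)].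
Proof.
move=> phi_proper f_proper [_ [fxbar _] _ [e [r [e0 r0 ball_int prox]]]].
have M1 : (1 : R) <= m%:R + 1 by rewrite lerDr.
have M0 : (0 : R) < m%:R + 1 by apply: lt_le_trans M1.
have enorm_lt (w : V) : `|w| < e / (m%:R + 1) -> enorm w < e.
  rewrite ltr_pdivlMr// mulrDr mulr1 => he; apply: le_lt_trans (enorm_le_norm w) _.
  by apply: le_lt_trans he; rewrite mulrC lerDl.
exists (e / (m%:R + 1)), r; split=> //; first by rewrite divr_gt0.
  by move=> x /enorm_lt; exact: ball_int.
move=> p x v /enorm_lt hp /enorm_lt hx fp fx Fp fv /enorm_lt hv.
have ip := ball_int _ hp; have dx := interior_edom (ball_int _ hx).
have fpe : (f p - f xbar < e%:E)%E.
  rewrite -(edom_fineK f_proper fp) -(fineK fxbar) -EFinB lte_fin ltrBlDl.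
  by apply: lt_le_trans Fp _; rewrite lerD2l ler_pdivrMr// ler_peMr// ltW.
have := prox x p v hx hp fpe fv hv.
rewrite (bregman_edom phi_proper ip dx) -(edom_fineK f_proper fp) -(edom_fineK f_proper fx).
by rewrite -EFinM -EFinN -!EFinD lee_fin.
Qed.

End ProxRegularity.

Section ConjugateGradient.
Context {R : realType} {m : nat}.
Local Notation V := 'rV[R]_m.
Context {phi : V -> \bar R} (phi_proper : eproper phi) (phi_convex : econvex phi).
Context (phi_diff : forall x, interior (edom phi) x -> ediff phi x).
Context (phi_esc : essentially_strictly_convex phi).
Context {xbar : V} {rho : R} (rho_gt0 : 0 < rho).
Context (ball_int : forall x, `|x - xbar| < rho -> interior (edom phi) x).

(** The case f = 0 of [tilted_argmin_smooth], where xbar minimizes the tilted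
    function of slope grad phi(xbar). *)
Lemma conjugate_smooth : exists2 delta : R, 0 < delta & exists q : V -> V,
  forall z, `|z - grad phi xbar| < delta ->
  [/\ `|q z - xbar| < rho, grad phi (q z) = z,
      fenchel_conj phi z = (dotp z (q z) - fine (phi (q z)))%:E,
      {for z, continuous q} &
      has_grad (fun w => dotp w (q w) - fine (phi (q w))) z (q z)].
Proof.
pose zero : V -> \bar R := fun=> 0%E.
have zero_dom x : edom zero x by exact: ltry.
have zero_proper : eproper zero by split; [move=> x; exact: ltNyr|exists xbar].
have zero_lsc : lower_semicontinuous zero.
  by move=> x a a0; exists setT; [exact: filterT|].
have [|||dq dq0 [q hq]] := tilted_argmin_smooth phi_proper phi_convex phi_diff phi_esc rho_gt0
    ball_int zero_proper zero_lsc (zero_dom xbar) ltr01 (vbar := 0) (r := 0) _ _ ltr01 _.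
- by rewrite mulr0 ltr01.
- by move=> x _ _; rewrite dotp0l mul0r subr0 addr0.
- by move=> p x v _ _ _ _ _ /regular_subdiff_cst0 -> _; rewrite dotp0l mul0r subr0 addr0.
rewrite scaler0 addr0 in hq.
have tilt0 z x : tilted phi zero 1 z x = fine (phi x) - dotp z x.
  by rewrite /tilted /= mulr0 add0r.
exists dq => //; exists q => z hz; have [[_ Bz] qmin _ qc qg] := hq z hz.
have {}qmin x : edom phi x -> fine (phi (q z)) - dotp z (q z) <= fine (phi x) - dotp z x.
  move=> dx; have [->//|/eqP xq] := eqVneq x (q z).
  by rewrite -!tilt0 ltW// qmin.
have iq := ball_int Bz; split=> //.
- have G0min x : edom zero x -> edom phi x ->
      tilted phi zero 1 z (q z) <= tilted phi zero 1 z x.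
    by move=> _ dx; rewrite !tilt0 qmin.
  have := tilted_min_regular_subdiff phi_diff zero_proper ltr01 (zero_dom _) iq G0min.
  move=> /regular_subdiff_cst0; rewrite invr1 scale1r => /eqP.
  by rewrite subr_eq0 => /eqP/esym.
- exact: (fenchel_conj_attained phi_proper (interior_edom iq)).
- rewrite (_ : (fun w => _) = (fun w => - tilted phi zero 1 w (q w)))//.
  by apply/funext => w; rewrite tilt0 opprB.
Qed.

End ConjugateGradient.

Unset Implicit Arguments.

Theorem proposition3p33 (R : realType) (m : nat)
    (phi f : 'rV[R]_m -> \bar R) (xbar vbar : 'rV[R]_m)
    (phi_Gamma0 : Gamma0 phi) (phi_legendre : legendre phi)
    (phi_super_coercive : super_coercive phi)
    (f_proper : eproper f) (f_lsc : lower_semicontinuous f)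
    (f_prox_bounded : prox_bounded phi f)
    (xbar_int : interior (edom phi) xbar) (xbar_dom : edom f xbar)
    (vbar_subgrad : limiting_subdiff f xbar vbar)
    (f_prox_regular : rel_prox_regular phi f xbar vbar) :
  exists2 lam0 : R, 0 < lam0 &
  forall lam : R, 0 < lam -> lam < lam0 ->
    (lam%:E < prox_threshold phi f)%E ->
    let env_conj := left_env phi lam f \o grad (fenchel_conj phi) in
    let ybar := grad phi xbar + lam *: vbar in
    [/\ C1_around env_conj ybar,
        (\forall y \near ybar, exists2 p : 'rV[R]_m,
           left_prox phi lam f (grad (fenchel_conj phi) y) = [set p] &
           grad env_conj y = lam^-1 *: (grad (fenchel_conj phi) y - p)) &
        (very_strictly_convex phi -> lipschitz_around (grad env_conj) ybar)].
Proof.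
have [phi_proper _ phi_convex] := phi_Gamma0.
have [[_ phi_diff _] phi_esc] := phi_legendre.
have [e [r [e0 r0 e_int prox_reg]]] := rel_prox_regular_ball phi_proper f_proper f_prox_regular.
(* The radius is fixed before lam, so that the ball on which grad phi is
   strongly monotone contains all minimizers that occur. *)
have [rho [rho0 rhoe [s s0 strong]]] : exists rho : R, [/\ 0 < rho, rho <= e &
    exists2 s : R, 0 < s & very_strictly_convex phi ->
    forall x y, `|x - xbar| < rho -> `|y - xbar| < rho ->
      s * `|x - y| ^+ 2 <= dotp (grad phi x - grad phi y) (x - y)].
  have [vsc|nvsc] := pselect (very_strictly_convex phi); last first.
    by exists e; split=> //; exists 1.
  have [rho rho0 [s s0 hs]] := grad_strongly_monotone xbar_int vsc.
  exists (Num.min rho e); split; rewrite ?lt_min ?rho0 ?ge_min ?lexx ?orbT//.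
  exists s => // _ x y; rewrite !lt_min => /andP[hx _] /andP[hy _]; exact: hs.
have ball_int x : `|x - xbar| < rho -> interior (edom phi) x.
  by move=> hx; apply: e_int; apply: lt_le_trans rhoe.
have loc p x v : `|p - xbar| < rho -> `|x - xbar| < rho -> edom f p -> edom f x ->
    fine (f p) < fine (f xbar) + e -> limiting_subdiff f p v -> `|v - vbar| < e ->
    fine (f p) + dotp v (x - p) - r * bregR phi x p <= fine (f x).
  by move=> hp hx; apply: prox_reg; apply: lt_le_trans rhoe.
have xbarB : `|xbar - xbar| < rho by rewrite subrr normr0.
have [r' rr' glob] : exists2 r' : R, r <= r' & forall x, edom f x -> edom phi x ->
    fine (f xbar) + dotp vbar (x - xbar) - r' * bregR phi x xbar <= fine (f x).
  apply: (prox_regular_minorant phi_proper phi_convex phi_diff phi_esc f_proper rho0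
    ball_int f_prox_bounded) => x fx hx.
  by apply: loc => //; rewrite ?ltrDl// subrr normr0.
have r'0 : 0 <= r' := le_trans r0 rr'.
(* As D is nonnegative, the larger constant r' serves locally as well. *)
have {}loc p x v : `|p - xbar| < rho -> `|x - xbar| < rho -> edom f p -> edom f x ->
    fine (f p) < fine (f xbar) + e -> regular_subdiff f p v -> `|v - vbar| < e ->
    fine (f p) + dotp v (x - p) - r' * bregR phi x p <= fine (f x).
  move=> hp hx fp fx Fp /regular_limiting_subdiff fv hv.
  apply: le_trans (loc _ _ _ hp hx fp fx Fp fv hv); rewrite lerD2l lerN2 ler_wpM2r//.
  by apply: (bregR_ge0 phi_proper phi_convex phi_diff); [apply: interior_edom|]; exact: ball_int.
have [dq dq0 [q hq]] := conjugate_smooth phi_proper phi_convex phi_diff phi_esc rho0 ball_int.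
have r'1 : 0 < r' + 1 by rewrite ltr_wpDl.
have v1 : 0 < `|vbar| + 1 by rewrite ltr_wpDl.
(* The first bound gives lam r' < 1; the second keeps lam vbar, hence ybar, within
   the radius dq around grad phi(xbar). *)
exists (Num.min (r' + 1)^-1 (dq / (`|vbar| + 1))).
  by rewrite lt_min invr_gt0 r'1 divr_gt0.
move=> lam lam0; rewrite lt_min => /andP[lamr lamq] _ env_conj ybar.
have lr : lam * r' < 1.
  move: lamr; rewrite -div1r ltr_pdivlMr// mulrDr mulr1; apply: le_lt_trans.
  by rewrite lerDl ltW.
have lv : `|lam *: vbar| < dq.
  rewrite normrZ gtr0_norm//; move: lamq; rewrite ltr_pdivlMr//; apply: le_lt_trans.
  by rewrite mulrDr mulr1 lerDl ltW.
have [dp dp0 [p hp]] := tilted_argmin_smooth phi_proper phi_convex phi_diff phi_esc rho0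
  ball_int f_proper f_lsc xbar_dom lam0 lr glob e0 loc.
pose N := [set z | `|z - ybar| < Num.min dp (dq - `|lam *: vbar|)].
have N0 : 0 < Num.min dp (dq - `|lam *: vbar|) by rewrite lt_min dp0 subr_gt0.
have Np z : N z -> `|z - ybar| < dp by rewrite /N /= lt_min => /andP[].
have Nq z : N z -> `|z - grad phi xbar| < dq.
  rewrite /N /= lt_min => /andP[_ hz].
  have -> : z - grad phi xbar = (z - ybar) + lam *: vbar.
    by rewrite /ybar opprD addrA subrK.
  by apply: le_lt_trans (ler_normD _ _) _; rewrite -ltrBrDr.
have nbN z : N z -> nbhs z N.
  exact: (near_norm_ball (W := 'rV[R]_m)).
have grad_conj z : N z -> grad (fenchel_conj phi) z = q z.
  move=> Nz; apply: has_grad_grad; have [_ _ _ _] := hq z (Nq z Nz).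
  apply: near_has_grad; apply: filterS (nbN z Nz) => w /Nq/hq[_ _ conjE _ _].
  by rewrite /= conjE.
(* The difference of the two conjugates, divided by lam. *)
pose val z := lam^-1 * (dotp z (q z) - fine (phi (q z)) - - tilted phi f lam z (p z)).
have envE z : N z -> env_conj z = (val z)%:E /\
    left_prox phi lam f (grad (fenchel_conj phi) z) = [set p z].
  move=> Nz; rewrite /env_conj /= grad_conj//.
  have [[fp hpz] pmin _ _ _] := hp z (Np z Nz).
  have [hqz gradq _ _ _] := hq z (Nq z Nz).
  have := left_env_prox_unique phi_proper f_proper lam0 (ball_int _ hqz) fp
    (interior_edom (ball_int _ hpz)).
  rewrite gradq => /(_ pmin)[-> ->]; split=> //.
  by rewrite /val opprK [in RHS]addrC.
have env_grad z : N z -> has_grad (fine \o env_conj) z (lam^-1 *: (q z - p z)).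
  move=> Nz; have [_ _ _ _ gq] := hq z (Nq z Nz); have [_ _ _ _ gp] := hp z (Np z Nz).
  have := has_gradZ lam^-1 (has_gradB gq gp).
  by apply: near_has_grad; apply: filterS (nbN z Nz) => w Nw /=; rewrite (envE w Nw).1.
have gradE z : N z -> grad env_conj z = lam^-1 *: (q z - p z).
  by move=> Nz; apply: has_grad_grad; exact: env_grad.
have Nybar : N ybar by rewrite /N /= subrr normr0.
split.
- apply: filterS (nbN _ Nybar) => z Nz; split.
  + by rewrite (envE z Nz).1.
  + by have [] := has_gradP (env_grad z Nz).
  + apply: (near_continuous (h := fun w => lam^-1 *: (q w - p w))).
      by apply: filterS (nbN z Nz) => w; exact: gradE.
    have [_ _ _ qc _] := hq z (Nq z Nz); have [_ _ _ pc _] := hp z (Np z Nz).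
    by apply: continuousZr; apply: continuousB.
- apply: filterS (nbN _ Nybar) => z Nz; exists (p z); first exact: (envE z Nz).2.
  by rewrite gradE// grad_conj.
- move=> /strong mono; exists N; first exact: nbN.
  have k0 : 0 < (1 - lam * r') * s by rewrite mulr_gt0// subr_gt0.
  exists (m%:R * (lam^-1 * (m%:R / s + m%:R / ((1 - lam * r') * s)))) => z w Nz Nw.
  rewrite !gradE//; apply: le_trans (enorm_le_norm _) _.
  rewrite -mulrA ler_wpM2l// -scalerBr normrZ gtr0_norm ?invr_gt0//.
  rewrite -mulrA ler_wpM2l ?invr_ge0 ?(ltW lam0)//.
  have -> : q z - p z - (q w - p w) = (q z - q w) - (p z - p w).
    by apply/rowP => i; rewrite !mxE; ring.
  apply: le_trans (ler_normB _ _) _; rewrite mulrDl lerD//.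
  + have [qz gradqz _ _ _] := hq z (Nq z Nz); have [qw gradqw _ _ _] := hq w (Nq w Nw).
    apply: (le_trans (strongly_monotone_lipschitz s0 _ (u := z - w))).
      by have := mono _ _ qz qw; rewrite gradqz gradqw.
    by rewrite ler_wpM2l ?norm_le_enorm// divr_ge0// ltW.
  + have [[_ pz] _ _ _ _] := hp z (Np z Nz); have [[_ pw] _ pm _ _] := hp w (Np w Nw).
    apply: (le_trans (strongly_monotone_lipschitz k0 _ (u := z - w))).
      apply: le_trans (pm z (Np z Nz)).
      by rewrite -mulrA ler_wpM2l ?mono// subr_ge0 ltW.
    by rewrite ler_wpM2l ?norm_le_enorm// divr_ge0// ltW.
Qed.
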